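(* For sufficiently large $n$, a unitary sampled from any ensemble $\mathcal{C}_n$ over $n$-qubit circuits composed of two-qubit gates with depth $\mathcal{O}(1)$ can be distinguished from an $n$-qubit unitary drawn at random from the Haar measure $\mu_H$ on $U(2^n)$ with non-negligible advantage, using $\mathcal{O}(n^4\log n)$ queries to the unknown unitary, in time $\mathrm{poly}(n)$. Thus, $\mathcal{C}_n$ is not an ensemble of pseudorandom unitaries.
   Context: An ensemble over circuits is a probability distribution on the $n$-qubit unitaries implemented by such circuits. A distinguisher is a quantum algorithm $\mathcal{A}^{U}(1^n)$ with black-box query access to an $n$-qubit unitary $U$ and outputting a bit; its advantage in distinguishing $\mathcal{C}_n$ from Haar is $\left|\Pr_{U\sim\mathcal{C}_n}[\mathcal{A}^U(1^n)=1]-\Pr_{U\sim\mu_H}[\mathcal{A}^U(1^n)=1]\right|$. A function is negligible if it is eventually smaller than $1/p(n)$ for every polynomial $p$. The depth is bounded by a constant independent of $n$. Pseudorandom unitaries (PRUs): let $n\in\mathbb{N}$ be the security parameter and $\mathcal{K}$ the key space. An infinite sequence $\{\mathcal{U}_n\}_{n\in\mathbb{N}}$ of $n$-qubit unitary ensembles $\mathcal{U}_n=\{U_k\}_{k\in\mathcal{K}}$ is pseudorandom if (i) (efficient computation) there is a polynomial-time quantum algorithm $\mathcal{Q}$ such that for all keys $k\in\mathcal{K}$ and all $n$-qubit pure states $|\psi\rangle$, $\mathcal{Q}(k,|\psi\rangle)=U_k|\psi\rangle$; and (ii) (pseudorandomness) for any quantum polynomial-time algorithm $\mathcal{A}$,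 $\left|\Pr_{k\sim\mathcal{K}}[\mathcal{A}^{U_k}(1^n)=1]-\Pr_{U\sim\mu_H}[\mathcal{A}^{U}(1^n)=1]\right|\le\mathrm{negl}(n)$. *)

(* Defs.v *)
(* MathComp and MathComp-Analysis; the complex numbers are R[i], R : realType. *)
From HB Require Import structures.
From mathcomp Require Import all_boot all_order all_algebra complex.
From mathcomp Require Import all_classical all_reals all_analysis.

Set Implicit Arguments.
Unset Strict Implicit.
Unset Printing Implicit Defensive.
Import Order.TTheory GRing.Theory Num.Theory numFieldNormedType.Exports.
Local Open Scope classical_set_scope.
Local Open Scope ring_scope.
Local Open Scope complex_scope.

(* The usual topology of the complex numbers, hence of complex matrices. *)
HB.instance Definition _ (R : realType) := PseudoPointedMetric.copy R[i] R[i]^o.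

(* Computational basis: the basis vector x : 'I_(2 ^ m) of m qubits stands for
   the bit string whose q-th bit, the value of qubit q, is the coefficient of
   2 ^ q in x. *)
Definition qubit (x q : nat) : bool := odd (x %/ 2 ^ q).

(* Reading the k qubits p 0, ..., p (k - 1) of x as one number below 2 ^ k. *)
Definition subindex (k : nat) (p : 'I_k -> nat) (x : nat) : nat :=
  (\sum_(i < k) qubit x (p i) * 2 ^ i)%N.

Lemma subindex_lt (k : nat) (p : 'I_k -> nat) (x : nat) :
  (subindex p x < 2 ^ k)%N.
Proof.
rewrite /subindex; elim: k p => [|k IH] p; first by rewrite big_ord0.
rewrite big_ord_recr /= expnS mul2n -addnn -addSn.
apply: leq_add; first exact: (IH (fun i => p (widen_ord (leqnSn k) i))).
by rewrite -[leqRHS]mul1n leq_mul2r leq_b1 orbT.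
Qed.

Definition subbasis (k : nat) (p : 'I_k -> nat) (x : nat) : 'I_(2 ^ k) :=
  Ordinal (subindex_lt p x).

(* The operator V on k qubits, acting on the qubits p 0, ..., p (k - 1) of an
   m-qubit register and as the identity on the others; it is meant for p
   injective with values below m. *)
Definition act_on (R : realType) (m k : nat) (p : 'I_k -> nat)
    (V : 'M[R[i]]_(2 ^ k)) : 'M[R[i]]_(2 ^ m) :=
  \matrix_(x, y)
    if [forall q : 'I_m, [forall i, p i != q] ==> (qubit x q == qubit y q)]
    then V (subbasis p x) (subbasis p y) else 0.

Definition pair_pos (a b : nat) : 'I_2 -> nat := fun i => nth 0%N [:: a; b] i.

Record gate (R : realType) (n : nat) := Gate2 {
  gate_fst : 'I_n;
  gate_snd : 'I_n;
  gate_mx : 'M[R[i]]_(2 ^ 2) }.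

(* A layer: unitary two-qubit gates on pairwise disjoint pairs of qubits. The
   pairs are arbitrary (no geometry). *)
Definition wf_layer (R : realType) (n : nat) (l : seq (gate R n)) : bool :=
  all (fun g => gate_mx g \is unitarymx) l &&
  uniq (flatten [seq [:: gate_fst g; gate_snd g] | g <- l]).

Definition layer_mx (R : realType) (n : nat) (l : seq (gate R n)) :
    'M[R[i]]_(2 ^ n) :=
  foldr (fun g M => act_on n (pair_pos (gate_fst g) (gate_snd g)) (gate_mx g) *m M)
    1%:M l.

Definition circuit_mx (R : realType) (n : nat) (c : seq (seq (gate R n))) :
    'M[R[i]]_(2 ^ n) :=
  foldr (fun l M => layer_mx l *m M) 1%:M c.

Definition depth_circuits (R : realType) (n d : nat) : set 'M[R[i]]_(2 ^ n) :=
  [set U | exists c : seq (seq (gate R n)),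
    [/\ (size c <= d)%N, all (@wf_layer R n) c & U = circuit_mx c]].

(* Complex 2^n x 2^n matrices with their Borel sigma-algebra. Ensembles of
   unitaries are Borel probability measures carried by unitary matrices. *)
Definition borel_mx (R : realType) (n : nat) :=
  g_sigma_algebraType (@open 'M[R[i]]_(2 ^ n)).

Definition circuit_ensemble (R : realType) (n d : nat)
    (P : probability (borel_mx R n) R) : Prop :=
  {ae P, forall U, @depth_circuits R n d U}.

Definition is_haar (R : realType) (n : nat)
    (P : probability (borel_mx R n) R) : Prop :=
  {ae P, forall U : 'M[R[i]]_(2 ^ n), U \is unitarymx} /\
  forall V : 'M[R[i]]_(2 ^ n), V \is unitarymx ->
  forall A : set (borel_mx R n), measurable A ->
    P [set U | A (V *m U)] = P A /\ P [set U | A (U *m V)] = P A.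

(* Classically controlled programs acting on a qubit memory. A register holds a
   natural number, used as a counter and as a qubit address. A program is a
   fixed finite text, so a program together with a polynomial memory size is a
   uniform algorithm. Running time is the number of executed instructions; a
   step raises the largest register content by at most one, so unit cost is
   polynomially related to bit cost. Restricting loops to be bounded makes every
   program terminate without losing any polynomial-time algorithm: nested loops
   iterate one machine step polynomially often, qubits serve as the tape. *)
Inductive cmd :=
| Skip
| Seq of cmd & cmd
| Incr of nat
| Decr of nat
| Copy of nat & nat            (* Copy r s: r := s *)
| IfEq of nat & nat & cmd & cmd
| Loop of nat & cmd            (* as many times as the register says on entry *)
| Gate of nat & nat & nat      (* Gate g r s: gate g on the qubits r and s point to *)
| Query of nat                 (* the oracle on the n qubits starting where r points *)
| Meas of nat & nat.        (* Meas r s: s := outcome for the qubit r points to *)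

(* One branch of an execution, for one sequence of measurement outcomes; its
   state vector is not renormalized, so that its squared norm is the probability
   of the branch. *)
Record config (R : realType) (m : nat) := Config {
  regs : nat -> nat;
  amps : 'cV[R[i]]_(2 ^ m);
  steps : nat;
  queries : nat }.

Section Semantics.
Variables (R : realType) (gates : seq 'M[R[i]]_(2 ^ 2)).
Variables (n m : nat) (U : 'M[R[i]]_(2 ^ n)).
Implicit Types (s : config R m).

Definition tick s := Config (regs s) (amps s) (steps s).+1 (queries s).

Definition set_reg (r v : nat) s :=
  Config [eta regs s with r |-> v] (amps s) (steps s) (queries s).

Definition map_amps (f : 'cV[R[i]]_(2 ^ m) -> 'cV[R[i]]_(2 ^ m)) s :=
  Config (regs s) (f (amps s)) (steps s) (queries s).

Definition project (q : nat) (b : bool) (v : 'cV[R[i]]_(2 ^ m)) :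
    'cV[R[i]]_(2 ^ m) :=
  \col_x (if qubit x q == b then v x 0 else 0).

(* A gate with an undefined index or with invalid addresses does nothing, as
   does a query that does not fit into memory (it is counted nevertheless); a
   measurement outside of memory yields 0. *)
Definition exec_gate (g r t : nat) s :=
  let a := regs s r in let b := regs s t in
  if [&& (g < size gates)%N, (a < m)%N, (b < m)%N & a != b]
  then map_amps (mulmx (act_on m (pair_pos a b) (nth 0 gates g))) s else s.

Definition exec_query (r : nat) s :=
  let a := regs s r in
  let s' := Config (regs s) (amps s) (steps s) (queries s).+1 in
  if (a + n <= m)%N
  then map_amps (mulmx (act_on m (fun i : 'I_n => (a + i)%N) U)) s' else s'.

Definition exec_measure (r t : nat) s :=
  let a := regs s r in
  if (a < m)%N
  then [seq set_reg t (nat_of_bool b) (map_amps (project a b) s) | b <- [:: false; true]]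
  else [:: set_reg t 0 s].

Fixpoint exec (c : cmd) s : seq (config R m) :=
  let bind f ss := flatten [seq f s' | s' <- ss] in
  match c with
  | Skip => [:: s]
  | Seq c1 c2 => bind (exec c2) (exec c1 s)
  | Incr r => [:: set_reg r (regs s r).+1 (tick s)]
  | Decr r => [:: set_reg r (regs s r).-1 (tick s)]
  | Copy r t => [:: set_reg r (regs s t) (tick s)]
  | IfEq r t c1 c2 =>
      if regs s r == regs s t then exec c1 (tick s) else exec c2 (tick s)
  | Loop r c1 =>
      iter (regs s r) (bind (fun s' => exec c1 (tick s'))) [:: tick s]
  | Gate g r t => [:: exec_gate g r t (tick s)]
  | Query r => [:: exec_query r (tick s)]
  | Meas r t => exec_measure r t (tick s)
  end.

End Semantics.

Record algorithm := Algorithm { prog : cmd; memory : {poly nat} }.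

Definition start (R : realType) (m : nat) (rs : nat -> nat)
    (v : 'cV[R[i]]_(2 ^ m)) : config R m := Config rs v 0 0.

(* The branches of A^U(1^n): register 0 holds n, the qubits are in the all-zero
   state. *)
Definition run (R : realType) (gates : seq 'M[R[i]]_(2 ^ 2)) (A : algorithm)
    (n : nat) (U : 'M[R[i]]_(2 ^ n)) : seq (config R (memory A).[n]) :=
  exec gates U (prog A)
    (start (fun r => if r == 0%N then n else 0%N) (\col_x (nat_of_ord x == 0%N)%:R)).

(* Pr[A^U(1^n) = 1]; the output bit is 1 when register 1 ends up nonzero. *)
Definition accept_pr (R : realType) (gates : seq 'M[R[i]]_(2 ^ 2))
    (A : algorithm) (n : nat) (U : 'M[R[i]]_(2 ^ n)) : R :=
  \sum_(s <- run gates A U | regs s 1 != 0%N)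
    \sum_x ((complex.Re (amps s x 0)) ^+ 2 + (complex.Im (amps s x 0)) ^+ 2).

Definition poly_time (R : realType) (gates : seq 'M[R[i]]_(2 ^ 2))
    (A : algorithm) : Prop :=
  exists p : {poly nat}, forall (n : nat) (U : 'M[R[i]]_(2 ^ n)),
    U \is unitarymx -> all (fun s => steps s <= p.[n])%N (run gates A U).

Definition makes_queries (R : realType) (gates : seq 'M[R[i]]_(2 ^ 2))
    (A : algorithm) (q : nat -> nat) : Prop :=
  forall (n : nat) (U : 'M[R[i]]_(2 ^ n)),
    U \is unitarymx -> all (fun s => queries s <= q n)%N (run gates A U).

Definition advantage (R : realType) (gates : seq 'M[R[i]]_(2 ^ 2))
    (A : algorithm) (n : nat) (P Q : probability (borel_mx R n) R) : R :=
  `| \int[P]_U accept_pr gates A U - \int[Q]_U accept_pr gates A U |%R.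

(* Algorithms may use any finite set of two-qubit gates containing the
   universal set {H, T, CNOT}, one-qubit gates being tensored with the identity
   on the second qubit. *)
Section Gates.
Variable R : realType.

Definition hadamard_mx : 'M[R[i]]_(2 ^ 1) :=
  \matrix_(x, y) ((-1) ^+ (qubit x 0 && qubit y 0) / (Num.sqrt 2)%:C).

Definition T_mx : 'M[R[i]]_(2 ^ 1) :=
  \matrix_(x, y) (if x != y then 0 else
    if qubit x 0 then (cos (pi / 4)) +i* (sin (pi / 4)) else 1).

Definition cnot_mx : 'M[R[i]]_(2 ^ 2) :=
  \matrix_(x, y) ((qubit x 0 == qubit y 0) &&
                  (qubit x 1 == qubit y 1 (+) qubit y 0))%:R.

Definition gate_set (gates : seq 'M[R[i]]_(2 ^ 2)) : Prop :=
  {in gates, forall V, V \is unitarymx} /\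
  {subset [:: act_on 2 (fun=> 0%N) hadamard_mx; act_on 2 (fun=> 0%N) T_mx; cnot_mx]
     <= gates}.

End Gates.

Definition negl (R : realType) (f : nat -> R) : Prop :=
  forall p : {poly R}, (\forall n \near \oo, 0 < p.[n%:R]) ->
    \forall n \near \oo, `|f n| < 1 / p.[n%:R].

(* Key k followed by zeros next to the n-qubit state v: qubits 0, ..., n - 1 are
   in state v, and the qubits from n on hold the bits of k. *)
Definition keyed_state (R : realType) (n m : nat) (k : seq bool)
    (v : 'cV[R[i]]_(2 ^ n)) : 'cV[R[i]]_(2 ^ m) :=
  \col_x (if [forall q : 'I_m, (n <= q)%N ==> (qubit x q == nth false k (q - n))]
          then v (subbasis (@nat_of_ord n) x) 0 else 0).

(* Q(k, |psi>) = U_k |psi>: whatever the measurement outcomes, the first n qubits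
   end up exactly in the pure state U_k |psi>, in tensor product with some state
   of the remaining qubits. Q is not given any oracle, i.e., it is given the
   trivial one. Registers 0 and 1 hold n and the length of the key. *)
Definition efficiently_computable (R : realType) (gates : seq 'M[R[i]]_(2 ^ 2))
    (len : nat -> nat) (K : forall n, {set (len n).-tuple bool})
    (U : forall n, (len n).-tuple bool -> 'M[R[i]]_(2 ^ n)) : Prop :=
  exists (Q : algorithm) (p : {poly nat}), forall n,
    let m := (memory Q).[n] in
    (n + len n <= m)%N /\
    forall (k : (len n).-tuple bool) (psi : 'cV[R[i]]_(2 ^ n)), k \in K n ->
      \sum_x `|psi x 0| ^+ 2 = 1 ->
      all (fun s => (steps s <= p.[n])%N &&
          `[< exists phi : nat -> R[i], forall x : 'I_(2 ^ m),
                amps s x 0 =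
                  (U n k *m psi) (subbasis (@nat_of_ord n) x) 0
                  * phi (x %/ 2 ^ n)%N >])
        (exec gates (1%:M : 'M[R[i]]_(2 ^ n)) (prog Q)
          (start (nth 0%N [:: n; len n]) (keyed_state m k psi))).

(* A sequence of ensembles is pseudorandom if it is the law of U_k for a key k
   uniform in a nonempty key space K n of bit strings, satisfying efficient
   computation and pseudorandomness with respect to the Haar measures muH. *)
Definition pseudorandom (R : realType) (gates : seq 'M[R[i]]_(2 ^ 2))
    (muH C : forall n, probability (borel_mx R n) R) : Prop :=
  exists (len : nat -> nat) (K : forall n, {set (len n).-tuple bool})
         (U : forall n, (len n).-tuple bool -> 'M[R[i]]_(2 ^ n)),
  [/\ forall n, K n != finset.set0,
      forall n k, k \in K n -> U n k \is unitarymx,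
      forall n (A : set (borel_mx R n)), measurable A ->
        C n A = ((\sum_(k in K n) nat_of_bool `[< A (U n k) >])%N%:R / #|K n|%:R)%:E,
      efficiently_computable gates K U &
      forall A : algorithm, poly_time gates A ->
        negl (fun n => advantage gates A (C n) (muH n))].

(* Main.v *)
Require Import Defs.
From HB Require Import structures.
From mathcomp Require Import all_boot all_order all_algebra complex.
From mathcomp Require Import spectral zify ring lra.
From mathcomp Require Import all_classical all_reals all_analysis.
From mathcomp Require Import measurable_realfun.
Set Implicit Arguments.
Unset Strict Implicit.
Unset Printing Implicit Defensive.
Import Order.TTheory GRing.Theory Num.Theory numFieldNormedType.Exports.
Local Open Scope classical_set_scope.
Local Open Scope ring_scope.
Local Open Scope complex_scope.

(** Let Z be the Pauli Z on the first qubit. The test prepares two copies of the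
    same random product state phi, applies U to both, measures the first qubit of
    each and accepts iff the outcomes agree. For a unitary U the acceptance
    probability is 1/2 + 1/2 E <U phi|Z|U phi>^2.

    For a circuit of depth d, the operator U^* Z U acts trivially outside a light
    cone of at most 2^d qubits. The projectors on the four probe states of a qubit
    span its operators, and averaging over them costs a factor of at most 48 for
    each qubit of the light cone, so that the expectation is at least 48^-(2^d).

    For Haar random U, Z may be replaced by any of the n pairwise anticommuting
    Majorana operators, because these are unitarily conjugate to Z. The squares of
    their expectations in a unit vector sum to at most 1, so that the expectation
    is at most 1/n. Two queries thus give a constant advantage for large n. *)

(** * Bits and local operators *)

(** A single copy would only reveal the mean of <Z>, a signed quantity that can cancel over the
    probe states or over the ensemble. Comparing two copies yields a square, which is bounded below
    for each circuit separately and therefore survives averaging over any ensemble. Both copies must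
    then be prepared in the same random state, although the machine has no source of randomness: a
    coin qubit is put in superposition, measured, and its outcome drives both copies. Of the gates,
    only H, T and CNOT are guaranteed, and H and T^2 already reach the probe states.

    On the Haar side, invariance under n fixed unitaries that rotate Z into the Majorana operators
    replaces a second-moment integral over the unitary group. The resulting 1/n is far above the
    true, exponentially small value, but it suffices because the bound for shallow circuits does not
    depend on n. *)

Definition num_of_bits (m : nat) (f : nat -> bool) : nat :=
  (\sum_(i < m) f i * 2 ^ i)%N.

Lemma num_of_bitsS (m : nat) (f : nat -> bool) :
  num_of_bits m.+1 f = (f 0 + (num_of_bits m (f \o succn)).*2)%N.
Proof.
rewrite /num_of_bits big_ord_recl muln1 -muln2 big_distrl /=; congr (_ + _)%N.
by apply: eq_bigr => i _; rewrite expnSr mulnA.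
Qed.

Lemma num_of_bits_lt (m : nat) (f : nat -> bool) : (num_of_bits m f < 2 ^ m)%N.
Proof.
elim: m f => [|m IH] f; first by rewrite /num_of_bits big_ord0.
rewrite num_of_bitsS expnS mul2n; have := IH (f \o succn).
by case: (f 0%N) => /=; lia.
Qed.

Lemma qubit0 (x : nat) : qubit x 0 = odd x.
Proof. by rewrite /qubit divn1. Qed.

Lemma qubitS (x q : nat) : qubit x q.+1 = qubit x./2 q.
Proof. by rewrite /qubit expnS divnMA divn2. Qed.

Lemma qubit_num_of_bits (m : nat) (f : nat -> bool) (q : nat) :
  (q < m)%N -> qubit (num_of_bits m f) q = f q.
Proof.
elim: m f q => // m IH f [|q] lt_q; rewrite num_of_bitsS.
  by rewrite qubit0 oddD odd_double addbF; case: (f 0%N).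
rewrite qubitS [in LHS](_ : (_ + _)./2 = num_of_bits m (f \o succn)) ?IH //.
by rewrite halfD odd_double andbF doubleK; case: (f 0%N).
Qed.

Lemma qubit_inj (m x y : nat) : (x < 2 ^ m)%N -> (y < 2 ^ m)%N ->
  (forall q, (q < m)%N -> qubit x q = qubit y q) -> x = y.
Proof.
elim: m x y => [|m IH] x y; first by rewrite expn0; case: x y => [|?] [|?].
rewrite expnS => ltx lty eqxy.
rewrite -(odd_double_half x) -(odd_double_half y).
have -> : odd x = odd y by rewrite -!qubit0 eqxy.
have -> // : x./2 = y./2; apply: IH => [||q lt_q].
- by rewrite ltn_half_double -mul2n.
- by rewrite ltn_half_double -mul2n.
- by rewrite -!qubitS eqxy.
Qed.

Definition bits (m : nat) (f : nat -> bool) : 'I_(2 ^ m) :=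
  Ordinal (num_of_bits_lt m f).

Lemma qubit_bits (m : nat) (f : nat -> bool) (q : nat) :
  (q < m)%N -> qubit (bits m f) q = f q.
Proof. exact: qubit_num_of_bits. Qed.

Lemma qubit_ord_inj (m : nat) (x y : 'I_(2 ^ m)) :
  (forall q, (q < m)%N -> qubit x q = qubit y q) -> x = y.
Proof. by move=> exy; apply: val_inj; apply: qubit_inj exy; exact: ltn_ord. Qed.

Lemma subindexE (k : nat) (p : 'I_k -> nat) (f : nat -> nat) (x : nat) :
  (forall i, p i = f i) ->
  subindex p x = num_of_bits k (fun i => qubit x (f i)).
Proof. by move=> pf; apply: eq_bigr => i _; rewrite pf. Qed.

Lemma qubit_subindex (k : nat) (p : 'I_k -> nat) (x : nat) (i : 'I_k) :
  qubit (subindex p x) i = qubit x (p i).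
Proof.
(* [num_of_bits] reads a function on [nat], so [p] is extended beyond [k] by the default 0. *)
rewrite (@subindexE _ _ (fun j => if insub j is Some i then p i else 0%N)).
  by rewrite qubit_num_of_bits // valK.
by move=> j; rewrite valK.
Qed.

Lemma qubit_subbasis (k : nat) (p : 'I_k -> nat) (x : nat) (i : 'I_k) :
  qubit (subbasis p x) i = qubit x (p i).
Proof. exact: qubit_subindex. Qed.

Lemma subbasis_eq (k : nat) (p p' : 'I_k -> nat) (x y : nat) :
  (forall i, qubit x (p i) = qubit y (p' i)) -> subbasis p x = subbasis p' y.
Proof.
move=> e; apply: qubit_ord_inj => q lt_q.
by rewrite -[q]/(val (Ordinal lt_q)) !qubit_subbasis e.
Qed.

Definition splice (m k : nat) (p : 'I_k -> nat) (x : nat) (z : nat) : 'I_(2 ^ m) :=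
  bits m (fun q => if [pick i | p i == q] is Some i then qubit z i else qubit x q).

(** Names the condition under which an entry of [act_on] can be nonzero, so that it can be folded
    after unfolding an entry. *)
Definition agree_off (m k : nat) (p : 'I_k -> nat) (x y : nat) : bool :=
  [forall q : 'I_m, [forall i, p i != q] ==> (qubit x q == qubit y q)].

Lemma agree_offP (m k : nat) (p : 'I_k -> nat) (x y : nat) :
  reflect (forall q, (q < m)%N -> (forall i, p i != q) -> qubit x q = qubit y q)
    (agree_off m p x y).
Proof.
apply: (iffP forallP) => [h q lt_q pq|h q].
  by have /implyP/(_ _)/eqP := h (Ordinal lt_q); apply; apply/forallP.
by apply/implyP => /forallP pq; apply/eqP/h.
Qed.

Lemma agree_off_sym (m k : nat) (p : 'I_k -> nat) (x y : nat) :
  agree_off m p x y = agree_off m p y x.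
Proof. by apply: eq_forallb => q; rewrite eq_sym. Qed.

Section Splice.
Variables (m k : nat) (p : 'I_k -> nat).
Hypotheses (p_inj : injective p) (p_lt : forall i, (p i < m)%N).

Lemma qubit_splice_in (x : nat) (z : nat) (i : 'I_k) :
  qubit (splice m p x z) (p i) = qubit z i.
Proof.
rewrite qubit_bits //; case: pickP => [j /eqP/p_inj -> //|/(_ i)].
by rewrite eqxx.
Qed.

Lemma qubit_splice_out (x : nat) (z : nat) (q : nat) : (q < m)%N ->
  (forall i, p i != q) -> qubit (splice m p x z) q = qubit x q.
Proof.
move=> lt_q pq; rewrite qubit_bits //; case: pickP => // j.
by rewrite (negbTE (pq j)).
Qed.

Lemma subbasis_splice (x : nat) (z : 'I_(2 ^ k)) :
  subbasis p (splice m p x z) = z.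
Proof.
apply: qubit_ord_inj => q lt_q; rewrite -[q]/(val (Ordinal lt_q)).
by rewrite qubit_subbasis qubit_splice_in.
Qed.

Lemma agree_off_splice (x : nat) (z : nat) :
  agree_off m p x (splice m p x z).
Proof. by apply/agree_offP => q lt_q pq; rewrite qubit_splice_out. Qed.

Lemma splice_agree_off (x : nat) (y : 'I_(2 ^ m)) :
  agree_off m p x y -> splice m p x (subbasis p y) = y.
Proof.
move=> /agree_offP xy; apply: qubit_ord_inj => q lt_q.
have [i /eqP <-|pq] := pickP [pred i | p i == q].
  by rewrite qubit_splice_in qubit_subbasis.
have npq i : p i != q by rewrite -[_ == _]/([pred i | p i == q] i) pq.
by rewrite qubit_splice_out // xy.
Qed.

Lemma sum_agree_off (V : nmodType) (x : nat) (F : 'I_(2 ^ m) -> V) :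
  \sum_(y : 'I_(2 ^ m) | agree_off m p x y) F y = \sum_(z : 'I_(2 ^ k)) F (splice m p x z).
Proof.
rewrite (reindex_onto (fun z : 'I_(2 ^ k) => splice m p x z) (subbasis p)); last first.
  by move=> y; exact: splice_agree_off.
apply: eq_bigl => z.
by rewrite agree_off_splice subbasis_splice eqxx.
Qed.

(** Row [x] of [act_on] is supported on the columns [splice m p x z]. The weight [W] is arbitrary,
    so that this serves products with matrices and with vectors alike. *)
Lemma act_on_mul_sum (R : realType) (V : 'M[R[i]]_(2 ^ k)) (x : 'I_(2 ^ m))
    (W : 'I_(2 ^ m) -> R[i]) :
  \sum_y act_on m p V x y * W y =
  \sum_(z : 'I_(2 ^ k)) V (subbasis p x) z * W (splice m p x z).
Proof.
transitivity (\sum_(y : 'I_(2 ^ m) | agree_off m p x y) V (subbasis p x) (subbasis p y) * W y).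
  rewrite [RHS]big_mkcond; apply: eq_bigr => y _; rewrite mxE -/(agree_off _ _ _ _).
  by case: ifP; rewrite ?mul0r.
by rewrite sum_agree_off; apply: eq_bigr => z _; rewrite subbasis_splice.
Qed.

Lemma act_onM (R : realType) (V W : 'M[R[i]]_(2 ^ k)) :
  act_on m p V *m act_on m p W = act_on m p (V *m W).
Proof.
apply/matrixP => x y; rewrite !mxE act_on_mul_sum -/(agree_off _ _ _ _).
have agr z : agree_off m p (splice m p x z) y = agree_off m p x y.
  by apply/agree_offP/agree_offP => h q lt_q pq;
    have := h q lt_q pq; rewrite qubit_splice_out.
case: ifP => axy; last first.
  rewrite big1 // => z _; rewrite mxE -/(agree_off _ _ _ _) agr axy; exact: mulr0.
by apply: eq_bigr => z _; rewrite !mxE -/(agree_off _ _ _ _) agr axy subbasis_splice.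
Qed.

End Splice.

(** * Adjoints *)

Definition adj (R : realType) (m n : nat) (M : 'M[R[i]]_(m, n)) : 'M[R[i]]_(n, m) :=
  map_mx conjc M^T.

Lemma adjE (R : realType) (m n : nat) (M : 'M[R[i]]_(m, n)) i j :
  adj M i j = (M j i)^*.
Proof. by rewrite !mxE. Qed.

Lemma adjK (R : realType) (m n : nat) (M : 'M[R[i]]_(m, n)) : adj (adj M) = M.
Proof. by apply/matrixP => i j; rewrite !adjE conjcK. Qed.

Lemma adjM (R : realType) (m n p : nat) (M : 'M[R[i]]_(m, n)) (N : 'M[R[i]]_(n, p)) :
  adj (M *m N) = adj N *m adj M.
Proof. by rewrite /adj trmx_mul map_mxM. Qed.

Lemma adj1 (R : realType) (n : nat) : adj (1%:M : 'M[R[i]]_n) = 1%:M.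
Proof. by rewrite /adj trmx1 map_mx1. Qed.

Lemma adjD (R : realType) (m n : nat) (M N : 'M[R[i]]_(m, n)) :
  adj (M + N) = adj M + adj N.
Proof. by apply/matrixP => i j; rewrite adjE !mxE rmorphD. Qed.

Lemma adjZ (R : realType) (m n : nat) (a : R[i]) (M : 'M[R[i]]_(m, n)) :
  adj (a *: M) = a^* *: adj M.
Proof. by apply/matrixP => i j; rewrite adjE !mxE rmorphM. Qed.

Lemma unitarymx_adj (R : realType) (n : nat) (U : 'M[R[i]]_n) :
  (U \is unitarymx) = (adj U *m U == 1%:M).
Proof.
by apply/unitarymxP/eqP => h; [apply: mulmx1C|have := mulmx1C h]; rewrite -?h.
Qed.

(** * Pauli operators, and operators that are trivial on a qubit *)

Section Qubits.
Variables (R : realType) (m : nat).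
Implicit Types (M N : 'M[R[i]]_(2 ^ m)) (q r : nat).

Definition flip q (x : nat) : 'I_(2 ^ m) := bits m (fun r => (r == q) (+) qubit x r).

Lemma qubit_flip q r (x : nat) : (r < m)%N -> qubit (flip q x) r = (r == q) (+) qubit x r.
Proof. exact: qubit_bits. Qed.

Lemma flipK q (x : 'I_(2 ^ m)) : flip q (flip q x) = x.
Proof. by apply: qubit_ord_inj => r lt_r; rewrite !qubit_flip // addKb. Qed.

Lemma flipC q r (x : 'I_(2 ^ m)) : flip q (flip r x) = flip r (flip q x).
Proof. by apply: qubit_ord_inj => s lt_s; rewrite !qubit_flip // addbCA. Qed.

Definition pauliX q : 'M[R[i]]_(2 ^ m) := \matrix_(x, y) (y == flip q x)%:R.

Definition sgn_bit q (x : nat) : R[i] := (-1) ^+ qubit x q.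

Definition pauliZ q : 'M[R[i]]_(2 ^ m) := \matrix_(x, y) (sgn_bit q x *+ (x == y)).

Lemma mul_pauliX q M x y : (pauliX q *m M) x y = M (flip q x) y.
Proof.
rewrite mxE (bigD1 (flip q x)) //= mxE eqxx mul1r big1 ?addr0 // => z nz.
by rewrite mxE (negbTE nz) mul0r.
Qed.

Lemma mulr_pauliX q M x y : (M *m pauliX q) x y = M x (flip q y).
Proof.
rewrite mxE (bigD1 (flip q y)) //= mxE flipK eqxx mulr1 big1 ?addr0 // => z nz.
rewrite mxE; case: eqP => [yz|]; last by rewrite mulr0.
by rewrite yz flipK eqxx in nz.
Qed.

Lemma mul_pauliZ q M x y : (pauliZ q *m M) x y = sgn_bit q x * M x y.
Proof.
rewrite mxE (bigD1 x) //= mxE eqxx big1 ?addr0 // => z nz.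
by rewrite mxE eq_sym (negbTE nz) mul0r.
Qed.

Lemma mulr_pauliZ q M x y : (M *m pauliZ q) x y = M x y * sgn_bit q y.
Proof.
rewrite mxE (bigD1 y) //= mxE eqxx big1 ?addr0 // => z nz.
by rewrite mxE (negbTE nz) mulr0.
Qed.

Lemma sgn_bit_sqr q (x : nat) : sgn_bit q x * sgn_bit q x = 1.
Proof. by rewrite -expr2 sqrr_sign. Qed.

Lemma sgn_bit_flip q r (x : nat) : (q < m)%N ->
  sgn_bit q (flip r x) = (-1) ^+ (q == r) * sgn_bit q x.
Proof. by move=> lt_q; rewrite /sgn_bit qubit_flip // signr_addb. Qed.

Lemma pauliX_adj q : adj (pauliX q) = pauliX q.
Proof.
apply/matrixP => x y; rewrite adjE !mxE conjc_nat; congr (nat_of_bool _)%:R.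
by apply/eqP/eqP => ->; rewrite flipK.
Qed.

Lemma conjc_sign (b : bool) : ((-1) ^+ b : R[i])^* = (-1) ^+ b.
Proof. exact: rmorph_sign. Qed.

Lemma pauliZ_adj q : adj (pauliZ q) = pauliZ q.
Proof.
apply/matrixP => x y; rewrite adjE !mxE eq_sym.
by case: eqP => [->|_]; rewrite ?mulr1n ?conjc_sign ?mulr0n ?conjc0.
Qed.

Lemma pauliX_sqr q : pauliX q *m pauliX q = 1%:M.
Proof. by apply/matrixP => x y; rewrite mul_pauliX !mxE flipK eq_sym. Qed.

Lemma pauliZ_sqr q : pauliZ q *m pauliZ q = 1%:M.
Proof.
apply/matrixP => x y; rewrite mul_pauliZ !mxE.
by case: eqP; rewrite ?mulr0 // mulr1n sgn_bit_sqr.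
Qed.

Lemma pauliXX q r : comm_mx (pauliX q) (pauliX r).
Proof. by apply/matrixP => x y; rewrite !mul_pauliX !mxE flipC. Qed.

Lemma pauliZZ q r : comm_mx (pauliZ q) (pauliZ r).
Proof.
by apply/matrixP => x y; rewrite !mul_pauliZ !mxE; case: eqP; rewrite ?mulr0 // mulrC.
Qed.

Lemma pauliZX q r : (r < m)%N ->
  pauliZ r *m pauliX q = (-1) ^+ (q == r) *: (pauliX q *m pauliZ r).
Proof.
move=> lt_r; apply/matrixP => x y; rewrite mulr_pauliX [RHS]mxE mulr_pauliZ !mxE.
rewrite (_ : (x == flip q y) = (y == flip q x)); last first.
  by apply/eqP/eqP => ->; rewrite flipK.
case: eqP => [->|_]; last by rewrite mulr0n mul0r mulr0.
by rewrite mulr1n mul1r sgn_bit_flip // eq_sym mulrA -expr2 sqrr_sign mul1r.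
Qed.

(** X and Z generate all operators of one qubit, so commuting with both means being the identity on
    qubit [q] tensored with an operator of the others. In this form, stability under products and
    adjoints is immediate and no tensor factorization has to be chosen. *)
Definition trivial_on q M : Prop := comm_mx (pauliX q) M /\ comm_mx (pauliZ q) M.

Lemma trivial_onM q M N : trivial_on q M -> trivial_on q N -> trivial_on q (M *m N).
Proof.
by rewrite /trivial_on /comm_mx => -[h1 h2] [h3 h4]; split;
  rewrite mulmxA ?h1 ?h2 -mulmxA ?h3 ?h4 mulmxA.
Qed.

Lemma trivial_on_adj q M : trivial_on q M -> trivial_on q (adj M).
Proof.
rewrite /trivial_on /comm_mx => -[h1 h2].
split; first by rewrite -[pauliX q]pauliX_adj -!adjM h1.
by rewrite -[pauliZ q]pauliZ_adj -!adjM h2.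
Qed.

Lemma trivial_on_pauliZ q r : (r < m)%N -> q != r -> trivial_on q (pauliZ r).
Proof.
move=> lt_r nqr; split; last exact: pauliZZ.
by rewrite /comm_mx pauliZX // (negbTE nqr) expr0 scale1r.
Qed.

Lemma trivial_on_flip q M (x y : 'I_(2 ^ m)) :
  trivial_on q M -> M (flip q x) (flip q y) = M x y.
Proof. by case=> h _; rewrite -mulr_pauliX -h mul_pauliX flipK. Qed.

Lemma trivial_on_eq0 q M (x y : 'I_(2 ^ m)) :
  trivial_on q M -> qubit x q != qubit y q -> M x y = 0.
Proof.
case=> _ /matrixP/(_ x y); rewrite mul_pauliZ mulr_pauliZ mulrC /sgn_bit => e nxy.
suff /eqP : M x y *+ 2 = 0 by rewrite mulrn_eq0 => /eqP.
apply/eqP; rewrite mulr2n addr_eq0; apply/eqP.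
by move: nxy e; case: (qubit x q); case: (qubit y q) => // _;
  rewrite expr0 expr1 mulr1 mulrN1 // => <-; rewrite ?opprK.
Qed.

Definition set_qubit q (b : bool) (x : nat) : 'I_(2 ^ m) :=
  bits m (fun r => if r == q then b else qubit x r).

Lemma qubit_set_qubit q b r (x : nat) : (r < m)%N ->
  qubit (set_qubit q b x) r = if r == q then b else qubit x r.
Proof. exact: qubit_bits. Qed.

Lemma set_qubitE q b (x : 'I_(2 ^ m)) :
  set_qubit q b x = if b == qubit x q then x else flip q x.
Proof.
apply: qubit_ord_inj => r lt_r; rewrite qubit_set_qubit //.
have [erq|nrq] := eqVneq r q.
  subst r; case: eqP => [->//|/eqP]; rewrite qubit_flip // eqxx.
  by case: b; case: (qubit x q).
by case: ifP => _ //; rewrite qubit_flip // (negbTE nrq).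
Qed.

Lemma trivial_on_set_qubit q b M (x y : 'I_(2 ^ m)) : trivial_on q M -> qubit x q = qubit y q ->
  M (set_qubit q b x) (set_qubit q b y) = M x y.
Proof. by move=> tM exy; rewrite !set_qubitE exy; case: ifP; rewrite ?trivial_on_flip. Qed.

(** If row and column agree on a qubit where [M] is trivial, their common value is irrelevant. The
    qubits of [A] are changed one at a time, in row and column simultaneously. *)
Lemma trivial_on_eq (A : seq nat) M (x y x' y' : 'I_(2 ^ m)) :
  {in A, forall q, (q < m)%N /\ trivial_on q M} ->
  (forall q, (q < m)%N -> q \notin A -> qubit x q = qubit x' q) ->
  (forall q, (q < m)%N -> q \notin A -> qubit y q = qubit y' q) ->
  {in A, forall q, qubit x q = qubit y q} ->
  {in A, forall q, qubit x' q = qubit y' q} ->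
  M x y = M x' y'.
Proof.
elim: A x y => [|q A IH] x y tM xx yy xy xy'.
  have -> : x = x' by apply: qubit_ord_inj => q lt_q; exact: xx.
  by have -> : y = y' by apply: qubit_ord_inj => q lt_q; exact: yy.
have qA : q \in q :: A by rewrite mem_head.
have [lt_q tq] := tM _ qA.
rewrite -(trivial_on_set_qubit (qubit x' q) tq (xy _ qA)).
apply: IH => [r rA|r lt_r rA|r lt_r rA|r rA|r rA].
- by apply: tM; rewrite inE rA orbT.
- by rewrite qubit_set_qubit //; case: eqVneq => [->//|nr]; rewrite xx // inE negb_or nr.
- rewrite qubit_set_qubit //; case: eqVneq => [->|nr]; first exact: xy'.
  by rewrite yy // inE negb_or nr.
- have rqA : r \in q :: A by rewrite inE rA orbT.
  by rewrite !qubit_set_qubit ?(xy _ rqA) //; case: (tM _ rqA).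
- by apply: xy'; rewrite inE rA orbT.
Qed.

End Qubits.

(** * Unitarity and commutation of local operators *)

Section ActOn.
Variables (R : realType) (m k : nat) (p : 'I_k -> nat).
Hypotheses (p_inj : injective p) (p_lt : forall i, (p i < m)%N).
Implicit Types V : 'M[R[i]]_(2 ^ k).

Lemma trmx_act_on V : (act_on m p V)^T = act_on m p V^T.
Proof.
apply/matrixP => x y; rewrite !mxE -!/(agree_off _ _ _ _) agree_off_sym.
by case: ifP.
Qed.

Lemma adj_act_on V : adj (act_on m p V) = act_on m p (adj V).
Proof.
apply/matrixP => x y; rewrite adjE !mxE -!/(agree_off _ _ _ _) agree_off_sym.
by case: ifP; rewrite ?conjc0.
Qed.

Lemma act_on1 : act_on m p (1%:M : 'M[R[i]]_(2 ^ k)) = 1%:M.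
Proof.
apply/matrixP => x y; rewrite !mxE -!/(agree_off _ _ _ _).
have [<-|nxy] := eqVneq x y.
  by rewrite eqxx; case: ifP => // /agree_offP[].
case: ifP => // axy; rewrite mulrb; case: eqP => // sxy; case/eqP: nxy.
rewrite -(splice_agree_off p_inj p_lt axy) -sxy splice_agree_off //.
by apply/agree_offP.
Qed.

Lemma act_on_unitary V : V \is unitarymx -> act_on m p V \is unitarymx.
Proof.
rewrite !unitarymx_adj => /eqP uV.
by rewrite adj_act_on act_onM // uV act_on1.
Qed.

Lemma trivial_on_act_on V q : (q < m)%N -> (forall i, p i != q) ->
  trivial_on q (act_on m p V).
Proof.
move=> lt_q npq; split; apply/matrixP => x y.
  rewrite mul_pauliX mulr_pauliX !mxE -!/(agree_off _ _ _ _).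
  have -> : subbasis p (flip m q x) = subbasis p x.
    by apply: subbasis_eq => i; rewrite qubit_flip // (negbTE (npq i)).
  have -> : subbasis p (flip m q y) = subbasis p y.
    by apply: subbasis_eq => i; rewrite qubit_flip // (negbTE (npq i)).
  congr (if _ then _ else _).
  apply/agree_offP/agree_offP => h r lt_r npr; have := h r lt_r npr;
    rewrite !qubit_flip //; last by move->; rewrite addKb.
  by move<-; rewrite addKb.
rewrite mul_pauliZ mulr_pauliZ !mxE -!/(agree_off _ _ _ _) mulrC.
by case: agree_offP => h; rewrite ?mul0r ?mulr0 // /sgn_bit h.
Qed.

Lemma trivial_comm_act_on V (M : 'M[R[i]]_(2 ^ m)) :
  (forall i, trivial_on (p i) M) -> comm_mx M (act_on m p V).
Proof.
move=> tM; apply/matrixP => x y.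
have sum1 (F G : 'I_(2 ^ k) -> R[i]) (z0 : 'I_(2 ^ k)) :
    (forall z : 'I_(2 ^ k), z != z0 -> G z = 0) -> \sum_z F z * G z = F z0 * G z0.
  by move=> G0; rewrite (bigD1 z0) //= big1 ?addr0 // => z /G0 ->; rewrite mulr0.
have qubit_neq (z z' : 'I_(2 ^ k)) : z != z' -> exists i : 'I_k, qubit z i != qubit z' i.
  move=> nz; apply/existsP; apply: contraR nz; rewrite negb_exists => /forallP h.
  apply/eqP/qubit_ord_inj => q lt_q.
  by have := h (Ordinal lt_q); rewrite negbK => /eqP.
(* [act_on_mul_sum] expands rows, while this product runs over a column of [act_on]; hence the
   transpose. In both products a single term survives, as [M] vanishes between basis states that
   differ at some [p j]. *)
transitivity (\sum_z (act_on m p V^T) y z * M x z).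
  by rewrite mxE; apply: eq_bigr => z _; rewrite -trmx_act_on [X in _ = X * _]mxE mulrC.
rewrite (act_on_mul_sum p_inj p_lt) (sum1 _ _ (subbasis p x)); last first.
  move=> z /qubit_neq[j]; rewrite qubit_subbasis => nz.
  by apply: (trivial_on_eq0 (tM j)); rewrite qubit_splice_in // eq_sym.
rewrite !mxE (act_on_mul_sum p_inj p_lt) (sum1 _ _ (subbasis p y)); last first.
  move=> z /qubit_neq[j]; rewrite qubit_subbasis => nz.
  by apply: (trivial_on_eq0 (tM j)); rewrite qubit_splice_in.
(* The two entries of [M] left differ only on the qubits [p i]: there row and column both carry the
   bits of [x] on one side, those of [y] on the other. *)
congr (_ * _); apply: (@trivial_on_eq _ _ (codom p)) => [q|q lt_q|q lt_q|q|q].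
- by case/codomP => i ->.
- by move=> npq; rewrite qubit_splice_out // => i; apply: contraNneq npq => <-; apply: codom_f.
- by move=> npq; rewrite qubit_splice_out // => i; apply: contraNneq npq => <-; apply: codom_f.
- by case/codomP => i ->; rewrite qubit_splice_in // qubit_subbasis.
- by case/codomP => i ->; rewrite qubit_splice_in // qubit_subbasis.
Qed.

End ActOn.

(** * Light cones of shallow circuits *)

Lemma pair_pos_inj (a b : nat) : a != b -> injective (pair_pos a b).
Proof.
move=> nab; have nba : b != a by rewrite eq_sym.
by case=> [[|[|i]] lti] // [[|[|j]] ltj] //= e; apply: val_inj => //=;
  move: e nab nba; rewrite /pair_pos /= => ->; rewrite eqxx.
Qed.

Lemma pair_posP (P : nat -> Prop) (a b : nat) :
  P a -> P b -> forall i, P (pair_pos a b i).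
Proof. by move=> Pa Pb [[|[|i]] lti]. Qed.

Section LightCone.
Variables (R : realType) (n : nat).
Implicit Types (M : 'M[R[i]]_(2 ^ n)) (S : {set 'I_n}) (g : gate R n).

Definition trivial_off S M : Prop := forall q : 'I_n, q \notin S -> trivial_on q M.

Definition gate_op g : 'M[R[i]]_(2 ^ n) :=
  act_on n (pair_pos (gate_fst g) (gate_snd g)) (gate_mx g).

Definition gate_pins g : seq 'I_n := [:: gate_fst g; gate_snd g].

Lemma gate_op_unitary g : gate_fst g != gate_snd g -> gate_mx g \is unitarymx ->
  gate_op g \is unitarymx.
Proof.
move=> ng; apply: act_on_unitary; first exact: pair_pos_inj.
exact: (@pair_posP (fun i => i < n)%N).
Qed.

(** A gate that avoids [S] commutes with [M] and cancels against its adjoint. Any other gate is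
    trivial off its own two pins. *)
Lemma trivial_off_conj S M g : gate_fst g != gate_snd g ->
  gate_mx g \is unitarymx -> trivial_off S M ->
  trivial_off (if has (mem S) (gate_pins g) then S :|: [set x in gate_pins g] else S)
    (adj (gate_op g) *m M *m gate_op g).
Proof.
move=> ng ug tM; have lt_g := @pair_posP (fun i => i < n)%N _ _
  (ltn_ord (gate_fst g)) (ltn_ord (gate_snd g)).
have inj_g := pair_pos_inj ng.
case: ifP => [_ q|/negbT/hasPn disj].
  rewrite !inE !negb_or => /and3P[qS q1 q2].
  have tg : trivial_on q (gate_op g).
    apply: trivial_on_act_on => //; apply: (@pair_posP (fun i => i != q)%N); rewrite eq_sym //.
  by do !apply: trivial_onM => //; [apply: trivial_on_adj|apply: tM].
have -> // : adj (gate_op g) *m M *m gate_op g = M.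
rewrite -mulmxA [M *m _](_ : _ = gate_op g *m M); last first.
  apply: trivial_comm_act_on => //.
  by apply: (@pair_posP (fun i => trivial_on i M)); apply: tM; apply: disj; rewrite !inE eqxx ?orbT.
by have := gate_op_unitary ng ug; rewrite unitarymx_adj mulmxA => /eqP ->; rewrite mul1mx.
Qed.

Lemma layer_unitary (l : seq (gate R n)) : wf_layer l -> layer_mx l \is unitarymx.
Proof.
elim: l => [|g l IH] /=; first by rewrite unitarymx_adj adj1 mulmx1.
rewrite /wf_layer /= inE negb_or -!andbA => /and5P[ug ul ng _ /andP[_ uniql]].
by apply: mul_unitarymx; [apply: gate_op_unitary|apply: IH; rewrite /wf_layer ul].
Qed.

Lemma circuit_unitary (c : seq (seq (gate R n))) :
  all (@wf_layer R n) c -> circuit_mx c \is unitarymx.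
Proof.
elim: c => [|l c IH] /=; first by rewrite unitarymx_adj adj1 mulmx1.
by case/andP=> /layer_unitary ul /IH; exact: mul_unitarymx.
Qed.

(* The gates of a layer are disjoint, so a gate that touches the enlarged support
   already touches S; each such gate adds at most one qubit. *)
Lemma layer_cone_count S M (l : seq (gate R n)) : wf_layer l -> trivial_off S M ->
  exists2 T, trivial_off T (adj (layer_mx l) *m M *m layer_mx l) &
    (#|T| <= #|S| + count (mem S) (flatten [seq gate_pins g | g <- l]))%N.
Proof.
elim: l S M => [|g l IH] S M.
  by move=> _ tM; exists S; rewrite ?addn0 //= adj1 mulmx1 mul1mx.
rewrite {1}/wf_layer /= inE negb_or -!andbA => /and5P[ug ul ng n1 /andP[n2 uniql]] tM.
have wl : wf_layer l by rewrite /wf_layer ul.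
have [T tT leT] := IH _ _ wl (trivial_off_conj ng ug tM).
exists T; first by rewrite adjM -!mulmxA !mulmxA in tT *; rewrite -!mulmxA in tT *.
apply: leq_trans leT _; rewrite /= orbF; case: ifP => [touch|_]; last first.
  by rewrite leq_add2l addnA leq_addl.
have -> : count (mem (S :|: [set x in gate_pins g])) (flatten [seq gate_pins g | g <- l])
    = count (mem S) (flatten [seq gate_pins g | g <- l]).
  apply: eq_in_count => x xl; rewrite /= !inE.
  have /negbTE -> : x != gate_fst g by apply: contraNneq n1 => <-.
  have /negbTE -> : x != gate_snd g by apply: contraNneq n2 => <-.
  by rewrite !orbF.
rewrite !addnA leq_add2r -addnA.
have -> : S :|: [set x in gate_pins g] = gate_fst g |: (gate_snd g |: S).
  by apply/setP => x; rewrite !inE orbC -orbA.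
rewrite !cardsU1 !inE negb_or ng /=; move: touch.
by move: (gate_fst g \in S) (gate_snd g \in S) #|S|; clear => -[] [] s //= _; lia.
Qed.

(** The pins of a layer are pairwise distinct, so at most #|S| of them lie in [S], and the support
    at most doubles. *)
Lemma layer_cone S M (l : seq (gate R n)) : wf_layer l -> trivial_off S M ->
  exists2 T, trivial_off T (adj (layer_mx l) *m M *m layer_mx l) & (#|T| <= 2 * #|S|)%N.
Proof.
move=> wl tM; have [T tT leT] := layer_cone_count wl tM; exists T => //.
apply: leq_trans leT _; rewrite mul2n -addnn leq_add2l -size_filter.
have /andP[_ uniql] := wl.
rewrite -(card_uniqP _) ?filter_uniq //.
by apply/subset_leq_card/fintype.subsetP => x; rewrite mem_filter => /andP[].
Qed.

Lemma circuit_cone S M (c : seq (seq (gate R n))) :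
  all (@wf_layer R n) c -> trivial_off S M ->
  exists2 T, trivial_off T (adj (circuit_mx c) *m M *m circuit_mx c) &
    (#|T| <= 2 ^ size c * #|S|)%N.
Proof.
elim: c S M => [|l c IH] S M /=.
  by move=> _ tM; exists S; rewrite ?mul1n // adj1 mulmx1 mul1mx.
case/andP=> wl wc tM; have [T tT leT] := layer_cone wl tM.
have [T' tT' leT'] := IH _ _ wc tT; exists T'; first by move: tT'; rewrite adjM !mulmxA.
by apply: leq_trans leT' _; rewrite expnSr -mulnA leq_mul2l leT orbT.
Qed.

End LightCone.

Lemma depth_circuits_unitary (R : realType) (n d : nat) (U : 'M[R[i]]_(2 ^ n)) :
  depth_circuits d U -> U \is unitarymx.
Proof. by case=> c [_ wc ->]; exact: circuit_unitary. Qed.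

Lemma depth_circuits_cone (R : realType) (n d : nat) (U : 'M[R[i]]_(2 ^ n)) :
  (0 < n)%N -> depth_circuits d U ->
  exists2 T : {set 'I_n}, trivial_off T (adj U *m pauliZ R n 0 *m U) & (#|T| <= 2 ^ d)%N.
Proof.
move=> lt0n [c [lec wc ->]].
have tZ : trivial_off [set Ordinal lt0n] (pauliZ R n 0).
  by move=> q; rewrite inE => nq; apply: trivial_on_pauliZ.
have [T tT leT] := circuit_cone wc tZ; exists T => //.
by apply: leq_trans leT _; rewrite cards1 muln1 leq_exp2l.
Qed.

(** * Probe states *)

Section Probes.
Variable R : realType.
Implicit Types (z w : R[i]) (u : bool -> R[i]).

Definition sqn z : R := complex.Re z ^+ 2 + complex.Im z ^+ 2.

Lemma sqn_ge0 z : 0 <= sqn z.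
Proof. by rewrite addr_ge0 ?sqr_ge0. Qed.

Lemma sqnM z w : sqn (z * w) = sqn z * sqn w.
Proof. case: z w => a b [c d]; rewrite /sqn /=; ring. Qed.

Lemma mul_conj_sqn z : z^* * z = (sqn z)%:C.
Proof.
case: z => a b; rewrite /sqn /=; apply/eqP; rewrite eq_complex /=.
by apply/andP; split; apply/eqP; ring.
Qed.

Lemma sqn_real (a : R) : sqn a%:C = a ^+ 2.
Proof. by rewrite /sqn /= expr0n addr0. Qed.

Definition apply1 (w : bool -> bool -> R[i]) u : bool -> R[i] :=
  fun a => w a false * u false + w a true * u true.

Definition hadamard1 (a b : bool) : R[i] := (-1) ^+ (a && b) / (Num.sqrt 2)%:C.

Definition phase1 (a b : bool) : R[i] :=
  if a != b then 0 else if a then (cos (pi / 4)) +i* (sin (pi / 4)) else 1.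

Definition ket0 (b : bool) : R[i] := (~~ b)%:R.

Definition coins : Type := (bool * bool * bool)%type.

(** The coins decide in turn on H, S = T^2 and H, as in the program [probe_qubit]. The eight
    outcomes give |0> and |+> three times each, |+i> and |-i> once each, up to phases. *)
Definition probe (c : coins) : bool -> R[i] :=
  let: (c1, c2, c3) := c in
  let u1 := if c1 then apply1 hadamard1 ket0 else ket0 in
  let u2 := if c2 then apply1 phase1 (apply1 phase1 u1) else u1 in
  if c3 then apply1 hadamard1 u2 else u2.

Definition norm1 u : R := sqn (u false) + sqn (u true).

Lemma sqrt2K : (Num.sqrt 2 : R)^-1 ^+ 2 = 2^-1.
Proof. by rewrite exprVn sqr_sqrtr. Qed.

Lemma real_complexV (a : R) : (a%:C)^-1 = (a^-1)%:C :> R[i].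
Proof. exact/esym/fmorphV. Qed.

Lemma apply1_hadamard u (a : bool) :
  apply1 hadamard1 u a = ((Num.sqrt 2)^-1)%:C * (u false + (-1) ^+ a * u true).
Proof. by rewrite /apply1 /hadamard1 real_complexV andbF andbT expr0; ring. Qed.

Lemma apply1_phase_twice u (a : bool) :
  apply1 phase1 (apply1 phase1 u) a = if a then 'i * u true else u false.
Proof.
(* [hc] and [hs] are the double-angle formulas at pi/4: the square of exp(i pi/4) is i. *)
have hc : cos (pi / 4) ^+ 2 - sin (pi / 4) ^+ 2 = 0 :> R.
  by rewrite !expr2 -cosD (_ : _ + _ = pi / 2) ?cos_pihalf //; field.
have hs : sin (pi / 4) * cos (pi / 4) + cos (pi / 4) * sin (pi / 4) = 1 :> R.
  by rewrite -sinD (_ : _ + _ = pi / 2) ?sin_pihalf //; field.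
case: a; rewrite /apply1 /phase1 /=; last by ring.
rewrite !mul0r !add0r mulrA; congr (_ * _).
by apply/eqP; rewrite eq_complex /=; apply/andP; split; apply/eqP; lra.
Qed.

(* The four states |0>, |+>, |+i>, |-i>, up to a phase; their projectors span all
   one-qubit operators. *)
Definition probe_proj (c : coins) (a b : bool) : R[i] :=
  match c with
  | (false, _, false) | (true, false, true) => (~~ a && ~~ b)%:R
  | (false, _, true) | (true, false, false) => (2^-1)%:C
  | (true, true, s) => if a == b then (2^-1)%:C else 0 +i* ((-1) ^+ (a (+) s) / 2)
  end.

Lemma probe_conj_mul (c : coins) (a b : bool) :
  (probe c a)^* * probe c b = probe_proj c a b.
Proof.
have h2 : (Num.sqrt 2 : R)^-1 ^+ 2 = 2^-1 := sqrt2K.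
(* Up to two Hadamards act on each of the two factors, which produces up to four powers of 1/sqrt
   2. *)
have h4 : (Num.sqrt 2 : R)^-1 ^+ 4 = 4^-1.
  by rewrite (exprM _ 2 2) h2; field.
case: c => [[c1 c2] c3]; move: c1 c2 c3 a b => [] [] [] [] []; rewrite /probe /probe_proj /=;
  rewrite ?apply1_hadamard ?apply1_phase_twice /= ?apply1_hadamard /ket0 /=;
  move: h2 h4; set h := _^-1 => h2 h4; apply/eqP; rewrite eq_complex /=;
  apply/andP; split; apply/eqP; try lra.
Qed.

Lemma probe_unit (c : coins) : norm1 (probe c) = 1.
Proof.
have e b : sqn (probe c b) = complex.Re (probe_proj c b b).
  by rewrite -probe_conj_mul mul_conj_sqn.
by rewrite /norm1 !e; case: c e => [[[] []] []] _ /=; lra.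
Qed.

Lemma sum_coins (F : coins -> R) :
  \sum_c F c = \sum_(c1 : bool) \sum_(c2 : bool) \sum_(c3 : bool) F (c1, c2, c3).
Proof.
transitivity (\sum_(p : bool * bool) \sum_(c3 : bool) F (p, c3)).
  by rewrite pair_bigA; apply: eq_bigr => -[].
by rewrite [RHS]pair_bigA; apply: eq_bigr => -[].
Qed.

Definition qform (q : bool -> bool -> R[i]) u : R[i] :=
  \sum_(a : bool) \sum_(b : bool) (u a)^* * u b * q a b.

Lemma qformE q u : qform q u =
  (u true)^* * u true * q true true + (u true)^* * u false * q true false +
  ((u false)^* * u true * q false true + (u false)^* * u false * q false false).
Proof. by rewrite /qform !big_bool. Qed.

(** The four probe projectors span the one-qubit operators, so the mean square of the expectations
    is a positive definite form in the entries of [q]. It therefore dominates a multiple of the sum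
    of their squared moduli. *)
Lemma probe_informative (q : bool -> bool -> R[i]) :
  48^-1 * \sum_(a : bool) \sum_(b : bool) sqn (q a b) <=
  8^-1 * \sum_c sqn (qform q (probe c)).
Proof.
have qE c : qform q (probe c) = \sum_(a : bool) \sum_(b : bool) probe_proj c a b * q a b.
  by apply: eq_bigr => a _; apply: eq_bigr => b _; rewrite probe_conj_mul.
rewrite sum_coins !big_bool !qE !big_bool /=.
case: (q true true) (q true false) (q false true) (q false false) =>
  [x1 y1] [x2 y2] [x3 y3] [x0 y0].
rewrite /sqn /=.
(* The real parts of the expectations only see the Hermitian part of [q], the imaginary parts the
   anti-Hermitian part, and [key] serves for both. Its weights 3/8, 3/8, 1/8, 1/8 count the coin
   outcomes leading to |0>, |+>, |+i>, |-i>; the last two are merged, their cross terms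
   cancelling. *)
have key (a0 a1 r t : R) :
  48^-1 * (a0 ^+ 2 + a1 ^+ 2 + (r ^+ 2 + t ^+ 2) / 2) <=
  3 / 8 * a0 ^+ 2 + 3 / 32 * (a0 + a1 + r) ^+ 2 + ((a0 + a1) ^+ 2 + t ^+ 2) / 16.
  have := sqr_ge0 (a0 + a1 + a0); have := sqr_ge0 (2 * (a0 + a1) + r).
  have := sqr_ge0 a0; have := sqr_ge0 (a0 + a1 + r); have := sqr_ge0 t.
  lra.
have := key x0 x1 (x2 + x3) (y2 - y3).
have := key y0 y1 (y2 + y3) (x2 - x3).
lra.
Qed.
End Probes.

(** * Expectations in random product states *)

Section ProductStates.
Variable R : realType.

Definition vsqn (N : nat) (v : 'cV[R[i]]_N) : R := \sum_x sqn (v x 0).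

Definition expval (N : nat) (M : 'M[R[i]]_N) (v : 'cV[R[i]]_N) : R[i] :=
  (adj v *m M *m v) 0 0.

Lemma expvalE (N : nat) (M : 'M[R[i]]_N) (v : 'cV[R[i]]_N) :
  expval M v = \sum_x \sum_y (v x 0)^* * v y 0 * M x y.
Proof.
rewrite /expval -mulmxA mxE; apply: eq_bigr => x _.
rewrite adjE mxE big_distrr /=; apply: eq_bigr => y _.
by rewrite -mulrA [v y 0 * _]mulrC.
Qed.

Lemma expval0 (N : nat) (v : 'cV[R[i]]_N) : expval 0 v = 0.
Proof. by rewrite /expval mulmx0 mul0mx mxE. Qed.

Lemma expval1 (N : nat) (v : 'cV[R[i]]_N) : expval 1%:M v = (vsqn v)%:C.
Proof.
rewrite /expval mulmx1 mxE rmorph_sum; apply: eq_bigr => x _.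
by rewrite adjE mul_conj_sqn.
Qed.

Definition prod_state (m : nat) (t : nat -> bool -> R[i]) : 'cV[R[i]]_(2 ^ m) :=
  \col_x \prod_(q < m) t q (qubit x q).

Definition extend (m : nat) (a : bool) (x : nat) : 'I_(2 ^ m.+1) :=
  bits m.+1 (fun q => if q == m then a else qubit x q).

Lemma qubit_extend_max (m : nat) a (x : nat) : qubit (extend m a x) m = a.
Proof. by rewrite qubit_bits ?eqxx. Qed.

Lemma qubit_extend (m : nat) a (x q : nat) : (q < m)%N -> qubit (extend m a x) q = qubit x q.
Proof. by move=> lt_q; rewrite qubit_bits ?ltnS ?(ltnW lt_q) // ltn_eqF. Qed.

Lemma sum_extend (V : nmodType) (m : nat) (F : 'I_(2 ^ m.+1) -> V) :
  \sum_x F x = \sum_(a : bool) \sum_(x : 'I_(2 ^ m)) F (extend m a x).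
Proof.
rewrite pair_bigA /=.
pose h (p : bool * 'I_(2 ^ m)) := extend m p.1 p.2.
pose h' (x : 'I_(2 ^ m.+1)) := (qubit x m, bits m (fun q => qubit x q)).
rewrite (reindex h) //; apply: onW_bij; exists h' => [[a x]|x]; rewrite /h /h' /=.
  rewrite qubit_extend_max; congr (_, _); apply: qubit_ord_inj => q lt_q.
  by rewrite qubit_bits // qubit_extend.
apply: qubit_ord_inj => q lt_q; rewrite [LHS]qubit_bits //; case: eqP => [->//|/eqP ne].
by rewrite qubit_num_of_bits // ltn_neqAle ne -ltnS.
Qed.

Lemma prod_state_extend (m : nat) (t : nat -> bool -> R[i]) a (x : 'I_(2 ^ m)) :
  prod_state m.+1 t (extend m a x) 0 = t m a * prod_state m t x 0.
Proof.
rewrite !mxE big_ord_recr /= qubit_extend_max mulrC; congr (_ * _).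
by apply: eq_bigr => q _; rewrite qubit_extend.
Qed.

Lemma vsqn_prod_state (m : nat) (t : nat -> bool -> R[i]) :
  vsqn (prod_state m t) = \prod_(q < m) norm1 (t q).
Proof.
elim: m => [|m IH].
  rewrite big_ord0 /vsqn (big_pred1 ord0) => [|[[|//] lt0]] //.
  by rewrite mxE big_ord0 /sqn /= expr1n expr0n addr0.
rewrite /vsqn sum_extend big_ord_recr /= -IH /vsqn.
under eq_bigr => a _ do
  (under eq_bigr => x _ do rewrite prod_state_extend sqnM; rewrite -big_distrr /=).
by rewrite big_bool /= /norm1 -mulrDl mulrC addrC.
Qed.

Definition block (m : nat) (a b : bool) (M : 'M[R[i]]_(2 ^ m.+1)) : 'M[R[i]]_(2 ^ m) :=
  \matrix_(x, y) M (extend m a x) (extend m b y).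

(** Fixing the state of the other qubits leaves a form in the state of the last qubit, to which
    [probe_informative] applies. *)
Lemma expval_block (m : nat) (t : nat -> bool -> R[i]) (M : 'M[R[i]]_(2 ^ m.+1)) :
  expval M (prod_state m.+1 t) =
  qform (fun a b => expval (block a b M) (prod_state m t)) (t m).
Proof.
rewrite expvalE sum_extend; apply: eq_bigr => a _.
under eq_bigr => x _ do rewrite sum_extend.
rewrite exchange_big; apply: eq_bigr => b _.
rewrite expvalE big_distrr; apply: eq_bigr => x _.
rewrite big_distrr; apply: eq_bigr => y _.
rewrite !prod_state_extend [block _ _ _ _ _]mxE rmorphM /=; ring.
Qed.

Lemma extend_flip (m q : nat) a (x : 'I_(2 ^ m)) : (q < m)%N ->
  extend m a (flip m q x) = flip m.+1 q (extend m a x).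
Proof.
move=> lt_q; apply: qubit_ord_inj => r; rewrite ltnS leq_eqVlt => /predU1P[->|lt_r].
  by rewrite qubit_extend_max qubit_flip // qubit_extend_max gtn_eqF.
by rewrite qubit_extend // !qubit_flip ?qubit_extend // ltnS ltnW.
Qed.

Lemma trivial_on_block (m q : nat) a b (M : 'M[R[i]]_(2 ^ m.+1)) : (q < m)%N ->
  trivial_on q M -> trivial_on q (block a b M).
Proof.
move=> lt_q tM; split; apply/matrixP => x y.
  rewrite mul_pauliX mulr_pauliX !mxE !extend_flip //.
  by rewrite -[in RHS](trivial_on_flip _ _ tM) flipK.
rewrite mul_pauliZ mulr_pauliZ !mxE mulrC /sgn_bit.
have [->//|ne] := eqVneq (qubit x q) (qubit y q).
by rewrite (trivial_on_eq0 tM) ?mul0r ?mulr0 // !qubit_extend.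
Qed.

Lemma flip_extend (m : nat) a (x : 'I_(2 ^ m)) :
  flip m.+1 m (extend m a x) = extend m (~~ a) x.
Proof.
apply: qubit_ord_inj => r lt_r; rewrite qubit_flip //.
move: lt_r; rewrite ltnS leq_eqVlt => /predU1P[->|lt_r].
  by rewrite !qubit_extend_max eqxx.
by rewrite !qubit_extend // ltn_eqF.
Qed.

Lemma block_trivial_diag (m : nat) (M : 'M[R[i]]_(2 ^ m.+1)) a :
  trivial_on m M -> block a a M = block false false M.
Proof.
case: a => // tM; apply/matrixP => x y.
by rewrite !mxE -(trivial_on_flip _ _ tM) !flip_extend.
Qed.

Lemma block_trivial_offdiag (m : nat) (M : 'M[R[i]]_(2 ^ m.+1)) a b :
  trivial_on m M -> a != b -> block a b M = 0.
Proof.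
move=> tM ab; apply/matrixP => x y.
by rewrite !mxE (trivial_on_eq0 tM) // !qubit_extend_max.
Qed.

Lemma mean_coins (a : R) : 8^-1 * \sum_(x : coins) a = a.
Proof.
by rewrite sumr_const !card_prod card_bool -[a *+ _]mulr_natr mulrCA mulVf ?mulr1 ?pnatr_eq0.
Qed.

(** Mean over independent uniform coins for the qubits below [k], the values from [k] on being those
    of [c]. Nesting the means, highest qubit innermost, matches both the recursion by [extend] and
    the turns of the program's loop. *)
Fixpoint avg (k : nat) (F : (nat -> coins) -> R) (c : nat -> coins) : R :=
  if k is k'.+1 then
    avg k' (fun c => 8^-1 * \sum_(x : coins) F (fun j => if j == k' then x else c j)) c
  else F c.

Lemma avg_le k F G c : (forall c, F c <= G c) -> avg k F c <= avg k G c.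
Proof.
elim: k F G c => [|k IH] F G c le //=; apply: IH => {}c.
by rewrite ler_pM2l ?invr_gt0 ?ltr0n //; apply: ler_sum.
Qed.

Lemma eq_avg k F G c : F =1 G -> avg k F c = avg k G c.
Proof. by move=> FG; apply/eqP; rewrite eq_le !avg_le // => c'; rewrite FG. Qed.

Lemma avgZ k a F c : avg k (fun c => a * F c) c = a * avg k F c.
Proof.
elim: k F c => [|k IH] F c //=; rewrite -IH; apply: eq_avg => {}c.
by rewrite -big_distrr mulrCA.
Qed.

Lemma avgD k F G c : avg k (fun c => F c + G c) c = avg k F c + avg k G c.
Proof.
elim: k F G c => [|k IH] F G c //=; rewrite -IH; apply: eq_avg => {}c.
by rewrite big_split mulrDr.
Qed.

Lemma avg_sum (I : Type) (r : seq I) k F c :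
  avg k (fun c => \sum_(j <- r) F j c) c = \sum_(j <- r) avg k (F j) c.
Proof.
elim: r => [|j r IH].
  rewrite big_nil (eq_avg _ _ (G := fun=> 0 * 0)) ?avgZ ?mul0r // => c'.
  by rewrite big_nil.
rewrite big_cons -IH -avgD; apply: eq_avg => c'; exact: big_cons.
Qed.

Lemma avg_cst k a c : avg k (fun=> a) c = a.
Proof.
elim: k => [|k IH] //=; rewrite -[RHS]IH; apply: eq_avg => c'.
exact: mean_coins.
Qed.

Definition probe_state (m : nat) (c : nat -> coins) : 'cV[R[i]]_(2 ^ m) :=
  prod_state m (fun q => probe R (c q)).

Lemma vsqn_probe_state (m : nat) (c : nat -> coins) : vsqn (probe_state m c) = 1.
Proof. by rewrite vsqn_prod_state big1 // => q _; rewrite probe_unit. Qed.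

Lemma eq_probe_state (m : nat) (c c' : nat -> coins) :
  (forall q, (q < m)%N -> c q = c' q) -> probe_state m c = probe_state m c'.
Proof.
by move=> e; apply/matrixP => x y; rewrite !mxE; apply: eq_bigr => q _; rewrite e.
Qed.

Lemma expval_probe_state (m : nat) (M : 'M[R[i]]_(2 ^ m.+1)) c x :
  expval M (probe_state m.+1 (fun j => if j == m then x else c j)) =
  qform (fun a b => expval (block a b M) (probe_state m c)) (probe R x).
Proof.
rewrite /probe_state expval_block eqxx; congr (qform _ _).
suff -> : prod_state m (fun q => probe R (if q == m then x else c q)) = probe_state m c.
  by [].
by apply: (@eq_probe_state m (fun q => if q == m then x else c q)) => q lt_q; rewrite ltn_eqF.
Qed.

(** Squared norm of row 0, which is 1 for a unitary of any size. The Frobenius norm would be counted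
    twice at each trivial qubit, whose two diagonal blocks coincide, whereas this row is then just
    the row of one block. *)
Definition row_sqn (m : nat) (M : 'M[R[i]]_(2 ^ m)) : R :=
  \sum_y sqn (M (bits m (fun=> false)) y).

Lemma row_sqn_block (m : nat) (M : 'M[R[i]]_(2 ^ m.+1)) :
  row_sqn M = row_sqn (block false false M) + row_sqn (block false true M).
Proof.
rewrite /row_sqn sum_extend big_bool addrC; congr (_ + _); apply: eq_bigr => y _;
  rewrite mxE; congr (sqn (M _ _)); apply: qubit_ord_inj => q lt_q;
  rewrite /extend [LHS]qubit_bits // [RHS]qubit_bits //;
  case: (eqVneq q m) => // ne; rewrite qubit_bits //;
  by rewrite ltn_neqAle ne -ltnS.
Qed.

Lemma row_sqn_ge0 (m : nat) (M : 'M[R[i]]_(2 ^ m)) : 0 <= row_sqn M.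
Proof. by apply: sumr_ge0 => y _; exact: sqn_ge0. Qed.

Lemma sum_bool2_ge (f : bool -> bool -> R) (k x y : R) :
  (forall a b, 0 <= f a b) -> k * x <= f false false -> k * y <= f false true ->
  k * (x + y) <= \sum_(a : bool) \sum_(b : bool) f a b.
Proof.
move=> ge0 lex ley; rewrite !big_bool /=.
have := ge0 true true; have := ge0 true false; lra.
Qed.

(** Induction that removes the highest qubit: a qubit in [P] costs a factor 48 by
    [probe_informative], a trivial one costs nothing. *)
Lemma avg_expval_lower (m : nat) (P : pred nat) (M : 'M[R[i]]_(2 ^ m)) c :
  (forall q, (q < m)%N -> ~~ P q -> trivial_on q M) ->
  48^-1 ^+ count P (iota 0 m) * row_sqn M <=
  avg m (fun c => sqn (expval M (probe_state m c))) c.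
Proof.
elim: m M c => [|m IH] M c tM.
  rewrite /= mul1r /row_sqn expvalE.
  have all0 (x : 'I_(2 ^ 0)) : x = ord0 by case: x => [[|//] lt0]; apply: val_inj.
  rewrite !(big_pred1 ord0) => [|x|x|x]; try by rewrite [x]all0.
  by rewrite !mxE big_ord0 rmorph1 !mul1r (all0 (bits 0 _)).
have -> : iota 0 m.+1 = rcons (iota 0 m) m by rewrite -addn1 iotaD cats1.
rewrite -cats1 count_cat /= addn0.
have tB a b q : (q < m)%N -> ~~ P q -> trivial_on q (block a b M).
  by move=> lt_q nP; apply: trivial_on_block => //; apply: tM => //; apply: ltnW.
have [Pm|nPm] := boolP (P m).
  rewrite addn1 exprS -mulrA row_sqn_block.
  apply: le_trans (_ : 48^-1 * (\sum_(a : bool) \sum_(b : bool)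
    avg m (fun c => sqn (expval (block a b M) (probe_state m c))) c) <= _).
    apply: ler_wpM2l; first by rewrite invr_ge0 ler0n.
    (* Row 0 only meets the two upper blocks; the averages for the lower ones are nonnegative and
       dropped. *)
    apply: sum_bool2_ge => [a b||]; try exact: IH _ c (tB _ _).
    apply: le_trans (IH _ c (tB a b)).
    by rewrite mulr_ge0 ?row_sqn_ge0 // exprn_ge0 // invr_ge0 ler0n.
  under eq_bigr => a _ do rewrite -avg_sum.
  rewrite -avg_sum -avgZ; apply: avg_le => c'.
  apply: le_trans (probe_informative _) _.
  rewrite ler_pM2l ?invr_gt0 ?ltr0n //; apply: ler_sum => x _.
  by rewrite expval_probe_state.
(* Here [M] is block diagonal with two equal blocks, so the probe of qubit [m] enters through its
   norm 1 only. *)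
rewrite addn0; have tm := tM _ (ltnSn m) nPm.
rewrite row_sqn_block (@block_trivial_offdiag _ _ false true tm) //.
have -> : row_sqn (0 : 'M[R[i]]_(2 ^ m)) = 0.
  by apply: big1 => y _; rewrite mxE /sqn /= expr0n addr0.
rewrite addr0; apply: le_trans (IH _ c (tB _ _)) _; apply: avg_le => c'.
have expE x : expval M (probe_state m.+1 (fun j => if j == m then x else c' j)) =
    expval (block false false M) (probe_state m c').
  rewrite expval_probe_state qformE.
  rewrite (block_trivial_diag true tm) (@block_trivial_offdiag _ _ false true tm) //.
  rewrite (@block_trivial_offdiag _ _ true false tm) //.
  rewrite !expval0 !mulr0 addr0 add0r -mulrDl !mul_conj_sqn addrC.
  have -> : (sqn (probe R x false))%:C + (sqn (probe R x true))%:C = 1.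
    by rewrite -[RHS](rmorph1 (real_complex R)) -(probe_unit R x) [RHS]rmorphD.
  exact: mul1r.
under eq_bigr => x _ do rewrite expE.
by rewrite mean_coins.
Qed.

End ProductStates.

(** * Majorana operators *)

Lemma adjZ_real (R : realType) (m n : nat) (a : R) (M : 'M[R[i]]_(m, n)) :
  adj (a%:C *: M) = a%:C *: adj M.
Proof. by rewrite adjZ; congr (_ *: _); exact: conjc_real. Qed.

Lemma scale_half_double (R : realType) (m n : nat) (M : 'M[R[i]]_(m, n)) :
  2^-1 *: (M + M) = M.
Proof. by rewrite -mulr2n -(scaler_nat 2 M) scalerA mulVf ?scale1r ?pnatr_eq0. Qed.

Section Expval.
Variables (R : realType) (N : nat) (v : 'cV[R[i]]_N).
Implicit Types M : 'M[R[i]]_N.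

Lemma expvalD M M' : expval (M + M') v = expval M v + expval M' v.
Proof. by rewrite /expval mulmxDr mulmxDl mxE. Qed.

Lemma expvalZ a M : expval (a *: M) v = a * expval M v.
Proof. by rewrite /expval -scalemxAr -scalemxAl mxE. Qed.

Lemma expval_sum (k : nat) (M : nat -> 'M[R[i]]_N) :
  expval (\sum_(j < k) M j) v = \sum_(j < k) expval (M j) v.
Proof.
elim: k => [|k IH]; first by rewrite !big_ord0 expval0.
by rewrite !big_ord_recr expvalD IH.
Qed.

Lemma expval_adj M : expval (adj M) v = (expval M v)^*.
Proof.
rewrite /expval -adjE; congr (fun_of_matrix _ 0 0).
by rewrite !adjM adjK mulmxA.
Qed.

Lemma expval_mul M : expval (adj M *m M) v = (vsqn (M *m v))%:C.
Proof. by rewrite -expval1 /expval mulmx1 adjM !mulmxA. Qed.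

Lemma expval_conj M (W : 'M[R[i]]_N) : expval (adj W *m M *m W) v = expval M (W *m v).
Proof. by rewrite /expval adjM !mulmxA. Qed.

Lemma vsqn_ge0 : 0 <= vsqn v.
Proof. by apply: sumr_ge0 => x _; exact: sqn_ge0. Qed.
End Expval.

(** * Sums of anticommuting Hermitian involutions *)

Section Clifford.
Variables (R : realType) (N : nat) (c : nat -> 'M[R[i]]_N) (m : nat).
Hypothesis cH : forall j, (j < m)%N -> adj (c j) = c j.
Hypothesis c2 : forall j, (j < m)%N -> c j *m c j = 1%:M.
Hypothesis cA : forall j k, (j < k < m)%N -> c j *m c k = - (c k *m c j).

Lemma clifford_sqr (a : nat -> R[i]) k : (k <= m)%N ->
  (\sum_(j < k) a j *: c j) *m (\sum_(j < k) a j *: c j) =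
  (\sum_(j < k) a j ^+ 2)%:M.
Proof.
elim: k => [|k IH] lek; first by rewrite !big_ord0 mulmx0 raddf0.
rewrite !big_ord_recr; set P := \sum_(j < k) a j *: c j.
have Pc : P *m c k = - (c k *m P).
  rewrite mulmx_suml mulmx_sumr -sumrN; apply: eq_bigr => j _.
  by rewrite -scalemxAl cA ?ltn_ord // -scalemxAr scalerN.
rewrite [LHS]mulmxDl !mulmxDr IH ?(ltnW lek) // [RHS]raddfD -[LHS]addrA; congr (_ + _).
rewrite -scalemxAr Pc -!scalemxAl -scalemxAr c2 // scalerA scalerN.
rewrite addrA addNr add0r expr2; exact: scalemx1.
Qed.

(** For a_j = <c_j>, S the sum of the a_j^2 and A the sum of the a_j c_j, anticommutation gives A^2
    = S, while <A> = S. The variance S - S^2 of A is nonnegative, so S is at most 1. *)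
Lemma clifford_expval (v : 'cV[R[i]]_N) : vsqn v = 1 ->
  \sum_(j < m) complex.Re (expval (c j) v) ^+ 2 <= 1.
Proof.
move=> v1; set a := fun j => complex.Re (expval (c j) v).
set S := (\sum_(j < m) _); pose A := \sum_(j < m) (a j)%:C *: c j.
have eA : expval A v = S%:C.
  rewrite (expval_sum v m (fun j => (a j)%:C *: c j)) rmorph_sum; apply: eq_bigr => j _.
  rewrite expvalZ rmorphXn expr2; congr (_ * _).
  (* A Hermitian operator has real expectation, so taking real parts in [a] loses nothing. *)
  have := expval_adj v (c j); rewrite cH // /a.
  by case: (expval _ v) => x y [/eqP]; rewrite -addr_eq0 -mulr2n mulrn_eq0 => /eqP ->.
have A2 : A *m A = S%:C%:M.
  have -> : S%:C = \sum_(j < m) (a j)%:C ^+ 2.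
    by rewrite rmorph_sum; apply: eq_bigr => j _; rewrite rmorphXn.
  exact: (clifford_sqr (fun j => (a j)%:C)).
have adjA : adj A = A.
  suff adjs k : (k <= m)%N ->
      adj (\sum_(j < k) (a j)%:C *: c j) = \sum_(j < k) (a j)%:C *: c j by exact: adjs.
  elim: k => [|k IH] lek.
    by rewrite !big_ord0; apply/matrixP => x y; rewrite adjE !mxE conjc0.
  by rewrite !big_ord_recr adjD adjZ_real IH 1?ltnW // cH.
pose s : R[i] := (- S)%:C; pose B := A + s *: 1%:M.
have adjB : adj B = B by rewrite adjD adjZ_real adj1 adjA.
have BB : adj B *m B = (S%:C + s * s) *: 1%:M + (2 * s) *: A.
  rewrite adjB mulmxDl !mulmxDr A2 -!scalemxAl -!scalemxAr !mulmx1 mul1mx scalerA.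
  rewrite scalerDl !scalemx1 -!addrA; congr (_ + _).
  by rewrite [RHS]addrC addrA -scalerDl -mulr2n mulr_natl.
have := vsqn_ge0 (B *m v).
have -> : vsqn (B *m v) = S - S ^+ 2.
  apply: complexI; rewrite -[LHS]expval_mul BB expvalD !expvalZ eA expval1 v1.
  rewrite rmorph1 mulr1 /s rmorphN rmorphB rmorphXn /=; ring.
by move=> le0; rewrite leNgt; apply/negP => lt1; nra.
Qed.

End Clifford.

(** The reflection (Z + G) / sqrt 2 exchanges Z and G, just as the Hadamard gate exchanges Pauli X
    and Z. *)
Lemma anticomm_rotation (R : realType) (N : nat) (Z G : 'M[R[i]]_N) :
  adj Z = Z -> adj G = G -> Z *m Z = 1%:M -> G *m G = 1%:M -> Z *m G = - (G *m Z) ->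
  exists2 V, V \is unitarymx & adj V *m Z *m V = G.
Proof.
move=> adjZ adjG Z2 G2 ZG.
pose h : R[i] := ((Num.sqrt 2)^-1)%:C; pose V := h *: (Z + G).
have hh : h * h = 2^-1 by rewrite -expr2 -rmorphXn /= sqrt2K -real_complexV rmorph_nat.
have adjV : adj V = V by rewrite adjZ_real adjD adjZ adjG.
exists V.
  rewrite unitarymx_adj adjV -scalemxAl -scalemxAr scalerA hh mulmxDl !mulmxDr Z2 G2 ZG.
  by rewrite addrA addrNK scale_half_double.
rewrite adjV -!scalemxAl -scalemxAr scalerA hh mulmxDl Z2 mulmxDl mul1mx mulmxDr.
rewrite -!mulmxA Z2 ZG mulmx1 mulmxN mulmxA G2 mul1mx.
by rewrite [G - Z]addrC addrACA subrr add0r scale_half_double.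
Qed.

Section Majorana.
Variables (R : realType) (m : nat).

Fixpoint stringX (j : nat) : 'M[R[i]]_(2 ^ m) :=
  if j is j'.+1 then stringX j' *m pauliX R m j' else 1%:M.

Lemma pauliX_string q j : comm_mx (pauliX R m q) (stringX j).
Proof.
elim: j => [|j IH] /=; first exact: comm_mx1.
by apply: comm_mxM => //; exact: pauliXX.
Qed.

Lemma stringX_comm j k : comm_mx (stringX j) (stringX k).
Proof.
elim: j => [|j IH] /=; first exact/comm_mx_sym/comm_mx1.
by apply/comm_mx_sym/comm_mxM; apply/comm_mx_sym => //; exact: pauliX_string.
Qed.

Lemma pauliZ_string r j : (r < m)%N ->
  pauliZ R m r *m stringX j = (-1) ^+ (r < j)%N *: (stringX j *m pauliZ R m r).
Proof.
move=> lt_r; elim: j => [|j IH] /=; first by rewrite mulmx1 mul1mx expr0 scale1r.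
rewrite mulmxA IH -scalemxAl -!mulmxA (pauliZX _ _ lt_r) -scalemxAr scalerA -signr_addb.
congr (_ ^+ nat_of_bool _ *: _).
by rewrite ltnS; case: (ltngtP r j).
Qed.

Lemma adj_stringX j : adj (stringX j) = stringX j.
Proof.
by elim: j => [|j IH] /=; rewrite ?adj1 // adjM IH pauliX_adj pauliX_string.
Qed.

Lemma stringX_sqr j : stringX j *m stringX j = 1%:M.
Proof.
elim: j => [|j IH] /=; first by rewrite mulmx1.
by rewrite -{2}pauliX_string mulmxA -[stringX j *m _ *m _]mulmxA pauliX_sqr mulmx1.
Qed.

(** Jordan-Wigner form with X and Z exchanged: X_0 ... X_(j-1) Z_j. For j < k the only sign arises
    when Z_j passes the X_j in the string of k, and index 0 gives the measured operator itself. *)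
Definition majorana (j : nat) : 'M[R[i]]_(2 ^ m) := stringX j *m pauliZ R m j.

Lemma majorana0 : majorana 0 = pauliZ R m 0.
Proof. exact: mul1mx. Qed.

Lemma pauliZ_string_comm r j : (r < m)%N -> (j <= r)%N ->
  pauliZ R m r *m stringX j = stringX j *m pauliZ R m r.
Proof. by move=> lt_r le_jr; rewrite pauliZ_string // ltnNge le_jr expr0 scale1r. Qed.

Lemma majorana_adj j : (j < m)%N -> adj (majorana j) = majorana j.
Proof.
by move=> lt_j; rewrite adjM pauliZ_adj adj_stringX pauliZ_string_comm.
Qed.

Lemma majorana_sqr j : (j < m)%N -> majorana j *m majorana j = 1%:M.
Proof.
move=> lt_j; rewrite {1}/majorana -pauliZ_string_comm // /majorana -mulmxA.
by rewrite [stringX j *m _]mulmxA stringX_sqr mul1mx pauliZ_sqr.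
Qed.

Lemma majorana_anticomm j k : (j < k < m)%N ->
  majorana j *m majorana k = - (majorana k *m majorana j).
Proof.
case/andP=> lt_jk lt_k; have lt_j := ltn_trans lt_jk lt_k.
have -> : majorana j *m majorana k =
    - (stringX j *m stringX k *m (pauliZ R m j *m pauliZ R m k)).
  rewrite /majorana mulmxA -[_ *m _ *m stringX k]mulmxA (pauliZ_string k lt_j) lt_jk.
  by rewrite expr1 scaleN1r mulmxN mulNmx !mulmxA.
rewrite stringX_comm pauliZZ; congr (- _).
rewrite /majorana [RHS]mulmxA -[_ *m _ *m stringX j]mulmxA.
by rewrite (pauliZ_string_comm lt_k (ltnW lt_jk)) !mulmxA.
Qed.

Lemma majorana_conj j : (j < m)%N ->
  exists2 V, V \is unitarymx & adj V *m majorana 0 *m V = majorana j.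
Proof.
case: j => [|j] lt_j.
  exists 1%:M; first by rewrite unitarymx_adj adj1 mulmx1.
  by rewrite adj1 mulmx1 mul1mx.
have lt_0 : (0 < m)%N by apply: leq_trans lt_j.
by apply: anticomm_rotation; rewrite ?majorana_adj ?majorana_sqr // majorana_anticomm ?lt_j.
Qed.

Lemma majorana_moment (v : 'cV[R[i]]_(2 ^ m)) : vsqn v = 1 ->
  \sum_(j < m) complex.Re (expval (majorana j) v) ^+ 2 <= 1.
Proof.
apply: clifford_expval; [exact: majorana_adj|exact: majorana_sqr|exact: majorana_anticomm].
Qed.

End Majorana.

(** * Product states and measurements *)

Lemma sum_one_qubit (V : nmodType) (F : bool -> V) :
  \sum_(z : 'I_(2 ^ 1)) F (qubit z 0) = F true + F false.
Proof.
rewrite (sum_extend (m := 0)) big_bool.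
by congr (_ + _); rewrite (big_pred1 ord0) => [|[[|//] lt0]] //; rewrite qubit_extend_max.
Qed.

Lemma prod_state_set_qubit (R : realType) (m : nat) (t : nat -> bool -> R[i]) q b
    (x : 'I_(2 ^ m)) (lt_q : (q < m)%N) :
  prod_state m t (set_qubit m q b x) 0 =
  t q b * \prod_(r < m | r != Ordinal lt_q) t r (qubit x r).
Proof.
rewrite mxE (bigD1 (Ordinal lt_q)) //= qubit_set_qubit // eqxx; congr (_ * _).
apply: eq_bigr => r; rewrite -val_eqE /= => /negbTE nr.
by rewrite qubit_set_qubit // nr.
Qed.

Lemma eq_prod_state (R : realType) (m : nat) (t t' : nat -> bool -> R[i]) :
  (forall q, (q < m)%N -> t q =1 t' q) -> prod_state m t = prod_state m t'.
Proof. by move=> e; apply/matrixP => x y; rewrite !mxE; apply: eq_bigr => q _; rewrite e. Qed.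

Definition update (T : Type) (t : nat -> T) (q : nat) (u : T) : nat -> T :=
  fun r => if r == q then u else t r.

Lemma prod_state_update (R : realType) (m : nat) (t : nat -> bool -> R[i]) q u
    (x : 'I_(2 ^ m)) (lt_q : (q < m)%N) :
  prod_state m (update t q u) x 0 =
  u (qubit x q) * \prod_(r < m | r != Ordinal lt_q) t r (qubit x r).
Proof.
rewrite mxE (bigD1 (Ordinal lt_q)) //= /update eqxx; congr (_ * _).
by apply: eq_bigr => r; rewrite -val_eqE /= => /negbTE ->.
Qed.

Lemma gate_prod_state (R : realType) (m a b : nat) (W : 'M[R[i]]_(2 ^ 1))
    (w : bool -> bool -> R[i]) (t : nat -> bool -> R[i]) :
  (forall x y, W x y = w (qubit x 0) (qubit y 0)) ->
  (a < m)%N -> (b < m)%N -> a != b ->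
  act_on m (pair_pos a b) (act_on 2 (fun=> 0%N) W) *m prod_state m t =
  prod_state m (update t a (apply1 w (t a))).
Proof.
move=> Ww lt_a lt_b nab; apply/matrixP => x y; rewrite [y]ord1 {y} mxE.
have p_inj := pair_pos_inj nab.
have p_lt : forall i, (pair_pos a b i < m)%N := @pair_posP (fun i => i < m)%N _ _ lt_a lt_b.
have z_inj : injective (fun _ : 'I_1 => 0%N) by move=> j j' _; rewrite [j]ord1 [j']ord1.
have z_lt (i : 'I_1) : (0 < 2)%N by [].
rewrite (act_on_mul_sum p_inj p_lt).
rewrite (act_on_mul_sum z_inj z_lt W (subbasis (pair_pos a b) x)
  (fun z => prod_state m t (splice m (pair_pos a b) x z) 0)).
(* A one-qubit gate is stored with a spectator, so two [act_on] are nested. Writing a bit into slot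
   0 of the pair and the pair back into [x] changes qubit [a] alone. *)
have sE (z : 'I_(2 ^ 1)) :
    splice m (pair_pos a b) x (splice 2 (fun _ : 'I_1 => 0%N) (subbasis (pair_pos a b) x) z)
    = set_qubit m a (qubit z 0) x.
  apply: qubit_ord_inj => q lt_q; rewrite qubit_set_qubit //.
  have [->|nqa] := eqVneq q a.
    rewrite (qubit_splice_in p_inj p_lt x _ (ord0 : 'I_2)).
    exact: (qubit_splice_in z_inj z_lt _ z ord0).
  have [->|nqb] := eqVneq q b.
    rewrite (qubit_splice_in p_inj p_lt x _ (lift ord0 ord0 : 'I_2)).
    rewrite (qubit_splice_out (m := 2) _ (z : nat)) //.
    exact: (qubit_subbasis _ _ (lift ord0 ord0 : 'I_2)).
  by rewrite qubit_splice_out //; apply: (@pair_posP (fun i => i != q)%N); rewrite eq_sym.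
under eq_bigr => z _ do rewrite sE (prod_state_set_qubit _ _ _ lt_a) Ww.
rewrite (sum_one_qubit (fun c => w _ c * (t a c * _))) (prod_state_update _ _ _ lt_a).
have -> : qubit (subbasis (fun _ : 'I_1 => 0%N) (subbasis (pair_pos a b) x)) 0 = qubit x a.
  rewrite (qubit_subbasis (fun _ : 'I_1 => 0%N) _ ord0).
  exact: (qubit_subbasis (pair_pos a b) x (ord0 : 'I_2)).
by rewrite /apply1 addrC !mulrA -mulrDl.
Qed.

Lemma project_prod_state (R : realType) (m q : nat) (b : bool) (t : nat -> bool -> R[i]) :
  (q < m)%N ->
  project q b (prod_state m t) =
  prod_state m (update t q (fun a => if a == b then t q a else 0)).
Proof.
move=> lt_q; apply/matrixP => x y; rewrite [y]ord1 (prod_state_update _ _ _ lt_q) !mxE.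
case: ifP => _; last by rewrite mul0r.
by rewrite (bigD1 (Ordinal lt_q)).
Qed.

(** * A coin and two copies of a state *)

Section Tensor.
Variables (R : realType) (n m : nat).
Hypothesis mE : m = (n + n).+1.
Implicit Types (u v : 'cV[R[i]]_(2 ^ n)) (anc : bool -> R[i]).

Definition block_pos (a : nat) : 'I_n -> nat := fun i => (a + i)%N.

(** The layout of the memory of the test. The size [m] stays abstract, tied down by [mE], since in a
    run it is a value of the memory polynomial. *)
Definition tensor anc u v : 'cV[R[i]]_(2 ^ m) :=
  \col_x (anc (qubit x 0) * u (subbasis (block_pos 1) x) 0
          * v (subbasis (block_pos n.+1) x) 0).

Lemma block_pos_inj a : injective (block_pos a).
Proof. by move=> i j /addnI/val_inj. Qed.

Lemma block_pos_lt1 (i : 'I_n) : (block_pos 1 i < m)%N.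
Proof. by rewrite mE ltnS /block_pos; have := ltn_ord i; lia. Qed.

Lemma block_pos_lt2 (i : 'I_n) : (block_pos n.+1 i < m)%N.
Proof. by rewrite mE ltnS /block_pos; have := ltn_ord i; lia. Qed.

Lemma act_on_tensor1 (U : 'M[R[i]]_(2 ^ n)) anc u v :
  act_on m (block_pos 1) U *m tensor anc u v = tensor anc (U *m u) v.
Proof.
have lt1 := block_pos_lt1; have inj1 := @block_pos_inj 1.
apply/matrixP => x y; rewrite [y]ord1 {y} mxE (act_on_mul_sum inj1 lt1) !mxE.
rewrite big_distrr big_distrl /=; apply: eq_bigr => z _; rewrite mxE subbasis_splice //.
rewrite qubit_splice_out ?mE //.
have -> : subbasis (block_pos n.+1) (splice m (block_pos 1) x z) =
    subbasis (block_pos n.+1) x.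
  apply: subbasis_eq => i; rewrite qubit_splice_out ?block_pos_lt2 // => j.
  by rewrite /block_pos; have := ltn_ord j; clear; lia.
by rewrite mulrA [anc _ * (_ * _)]mulrCA !mulrA.
Qed.

Lemma act_on_tensor2 (U : 'M[R[i]]_(2 ^ n)) anc u v :
  act_on m (block_pos n.+1) U *m tensor anc u v = tensor anc u (U *m v).
Proof.
have lt2 := block_pos_lt2; have inj2 := @block_pos_inj n.+1.
apply/matrixP => x y; rewrite [y]ord1 {y} mxE (act_on_mul_sum inj2 lt2) !mxE.
rewrite big_distrr /=; apply: eq_bigr => z _; rewrite mxE subbasis_splice //.
rewrite qubit_splice_out ?mE //.
have -> : subbasis (block_pos 1) (splice m (block_pos n.+1) x z) = subbasis (block_pos 1) x.
  apply: subbasis_eq => i; rewrite qubit_splice_out ?block_pos_lt1 // => j.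
  by rewrite /block_pos; have := ltn_ord i; clear; lia.
by rewrite mulrCA.
Qed.

Lemma project_tensor1 b anc u v : (0 < n)%N ->
  project 1 b (tensor anc u v) = tensor anc (project 0 b u) v.
Proof.
move=> lt0n; apply/matrixP => x y; rewrite [y]ord1 !mxE.
rewrite -[X in qubit x X]/(block_pos 1 (Ordinal lt0n)) -qubit_subbasis /=.
by case: ifP; rewrite ?mulr0 ?mul0r.
Qed.

Lemma project_tensor2 b anc u v : (0 < n)%N ->
  project n.+1 b (tensor anc u v) = tensor anc u (project 0 b v).
Proof.
move=> lt0n; apply/matrixP => x y; rewrite [y]ord1 !mxE.
have -> : qubit x n.+1 = qubit (subbasis (block_pos n.+1) x) 0.
  by rewrite (qubit_subbasis _ x (Ordinal lt0n)) /block_pos addn0.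
by case: ifP; rewrite ?mulr0.
Qed.

Lemma vsqn_tensor anc u v : vsqn (tensor anc u v) = norm1 anc * vsqn u * vsqn v.
Proof.
pose glue (p : bool * ('I_(2 ^ n) * 'I_(2 ^ n))) : 'I_(2 ^ m) :=
  bits m (fun q => if q == 0%N then p.1 else
    if (q <= n)%N then qubit p.2.1 q.-1 else qubit p.2.2 (q - n.+1)).
pose cut (x : 'I_(2 ^ m)) :=
  (qubit x 0, (subbasis (block_pos 1) x, subbasis (block_pos n.+1) x)).
have glueK : cancel glue cut.
  case=> b [y z]; rewrite /cut; congr (_, (_, _)).
  - by rewrite qubit_bits ?mE.
  - apply: qubit_ord_inj => q lt_q; rewrite (qubit_subbasis _ _ (Ordinal lt_q)).
    by rewrite qubit_bits ?block_pos_lt1 // /block_pos /= add1n /= lt_q.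
  - apply: qubit_ord_inj => q lt_q; rewrite (qubit_subbasis _ _ (Ordinal lt_q)).
    rewrite qubit_bits ?block_pos_lt2 // /block_pos addSn /= -addSn addKn.
    by rewrite leqNgt addSn ltnS leq_addr.
have cutK : cancel cut glue.
  move=> x; apply: qubit_ord_inj => q lt_q; rewrite qubit_bits // /cut /=.
  case: q lt_q => //= q lt_q; case: ifP => le_q.
    by rewrite (qubit_subindex _ _ (Ordinal le_q)).
  have lt_qn : (q - n < n)%N by move: lt_q le_q; rewrite mE; clear; lia.
  rewrite subSS (qubit_subindex _ _ (Ordinal lt_qn)) /block_pos /= addSn subnKC //.
  by rewrite leqNgt le_q.
rewrite /vsqn (reindex glue) /=; last by apply: onW_bij; exists cut.
rewrite -(pair_bigA _ (fun b p => sqn (tensor anc u v (glue (b, p)) 0))) /=.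
transitivity (\sum_(b : bool) \sum_(y : 'I_(2 ^ n)) \sum_(z : 'I_(2 ^ n))
  sqn (anc b) * sqn (u y 0) * sqn (v z 0)).
  apply: eq_bigr => b _; rewrite pair_bigA; apply: eq_bigr => -[y z] _ /=.
  have e := glueK (b, (y, z)).
  have e1 : qubit (glue (b, (y, z))) 0 = b := congr1 fst e.
  have e2 : subbasis (block_pos 1) (glue (b, (y, z))) = y := congr1 (fun p => p.2.1) e.
  have e3 : subbasis (block_pos n.+1) (glue (b, (y, z))) = z := congr1 (fun p => p.2.2) e.
  by rewrite mxE !sqnM e1 e2 e3.
transitivity (\sum_(b : bool) sqn (anc b) * (vsqn u * vsqn v)); last first.
  by rewrite -big_distrl big_bool /= -/(vsqn u) -/(vsqn v) /norm1 addrC !mulrA.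
apply: eq_bigr => b _; rewrite big_distrl big_distrr /=; apply: eq_bigr => y _.
by rewrite mulrA big_distrr.
Qed.

Lemma prod_state_tensor anc (s : nat -> bool -> R[i]) (t : nat -> bool -> R[i]) :
  t 0%N =1 anc -> (forall j, (j < n)%N -> t j.+1 =1 s j) ->
  (forall j, (j < n)%N -> t (n.+1 + j)%N =1 s j) ->
  prod_state m t = tensor anc (prod_state n s) (prod_state n s).
Proof.
move=> t0 t1 t2; apply/matrixP => x y; rewrite [y]ord1 !mxE.
move: x; rewrite mE => x.
rewrite big_ord_recl t0 big_split_ord mulrA; congr (_ * _ * _);
  apply: eq_bigr => j _; rewrite qubit_subindex /=.
  by rewrite t1.
by rewrite /bump /= add1n -addSn t2.
Qed.

End Tensor.

(** * The distinguisher *)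

Definition on_both (g : nat) : cmd := Seq (Gate g 2 1) (Gate g 3 1).

(** Register 1 holds 0, the address of the coin. Register 4 holds 1 and serves as the constant with
    which the outcome is compared. The qubit that register 2 points to is the spectator of the
    Hadamard. *)
Definition coin_step (h : nat) (c : cmd) : cmd :=
  Seq (Gate h 1 2) (Seq (Meas 1 5) (IfEq 5 4 c Skip)).

Definition probe_qubit (h t : nat) : cmd :=
  Seq (coin_step h (on_both h))
  (Seq (coin_step h (Seq (on_both t) (on_both t)))
  (Seq (coin_step h (on_both h)) (Seq (Incr 2) (Incr 3)))).

(** The n turns of the loop have moved register 2 from qubit 1 to qubit n + 1, where the second copy
    starts. Register 1, so far the coin address 0, becomes the output. *)
Definition compare_copies : cmd :=
  Seq (Query 4) (Seq (Query 2) (Seq (Meas 4 5) (Seq (Meas 2 6)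
  (IfEq 5 6 (Incr 1) Skip)))).

(* Qubit 0 is a coin; the two copies of the probe state are held by qubits 1 to n
   and n + 1 to 2 n. Register 2 (resp. 3) points to the current qubit of the
   first (resp. second) copy, and register 4 to qubit 1. *)
Definition distinguisher (h t : nat) : cmd :=
  Seq (Incr 2) (Seq (Copy 3 0) (Seq (Incr 3) (Seq (Incr 4)
  (Seq (Loop 0 (probe_qubit h t)) compare_copies)))).

(** * Execution of the probe loop *)

Section Program.
Variables (R : realType) (gates : seq 'M[R[i]]_(2 ^ 2)) (n m : nat).
Variables (U : 'M[R[i]]_(2 ^ n)) (h t : nat).
Hypothesis mE : m = (n + n).+1.

Definition is_gate1 (g : nat) (w : bool -> bool -> R[i]) : Prop :=
  (g < size gates)%N /\ exists2 W : 'M[R[i]]_(2 ^ 1),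
    nth 0 gates g = act_on 2 (fun=> 0%N) W & forall x y, W x y = w (qubit x 0) (qubit y 0).

Hypothesis hP : is_gate1 h (@hadamard1 R).
Hypothesis tP : is_gate1 t (@phase1 R).

Notation exec := (exec gates U (m := m)).
Implicit Types (s : config R m) (u anc : bool -> R[i]) (tau : nat -> bool -> R[i]).

(** Summing a function over the final branches turns sequencing into composition, so the list of
    branches never has to be written down. *)
Definition branch_sum (c : cmd) (F : config R m -> R) s : R := \sum_(s' <- exec c s) F s'.

Lemma branch_sum_Seq c1 c2 F s :
  branch_sum (Seq c1 c2) F s = branch_sum c1 (branch_sum c2 F) s.
Proof. by rewrite /branch_sum /= big_flatten big_map. Qed.

Lemma exec_Seq1 c1 c2 s s1 : exec c1 s = [:: s1] -> exec (Seq c1 c2) s = exec c2 s1.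
Proof. by move=> /= ->; rewrite /= cats0. Qed.

Lemma exec_Seq2 c1 c2 s s0 s1 :
  exec c1 s = [:: s0; s1] -> exec (Seq c1 c2) s = exec c2 s0 ++ exec c2 s1.
Proof. by move=> /= ->; rewrite /= cats0. Qed.

Lemma exec_Meas r r' s : (regs s r < m)%N ->
  exec (Meas r r') s = [seq Config [eta regs s with r' |-> nat_of_bool b]
    (project (regs s r) b (amps s)) (steps s).+1 (queries s) | b <- [:: false; true]].
Proof. by move=> lt_r; rewrite /= /exec_measure /= lt_r. Qed.

Lemma exec_gate1 g r r' s w T : is_gate1 g w ->
  (regs s r < m)%N -> (regs s r' < m)%N -> regs s r != regs s r' ->
  amps s = prod_state m T ->
  exec (Gate g r r') s =
    [:: Config (regs s) (prod_state m (update T (regs s r) (apply1 w (T (regs s r)))))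
         (steps s).+1 (queries s)].
Proof.
move=> [lt_g [W gE WE]] lt_r lt_r' nr sE.
rewrite /= /exec_gate /= lt_g lt_r lt_r' nr /= /map_amps /= sE gE.
by rewrite (gate_prod_state T WE lt_r lt_r' nr).
Qed.

Definition copies anc tau : nat -> bool -> R[i] := fun q =>
  if q == 0%N then anc else if (q <= n)%N then tau q.-1 else tau (q - n.+1)%N.

(** Loop invariant after [k] qubits. The state remains a product; the coin is a multiple of a basis
    state, and its squared norm carries the weight [w] of the branch. *)
Definition ready k tau (w : R) s : Prop :=
  [/\ regs s 0 = n, regs s 1 = 0%N, regs s 2 = k.+1, regs s 3 = (n + k).+1 & regs s 4 = 1%N]
  /\ exists anc, [/\ amps s = prod_state m (copies anc tau),
                     exists b, anc (~~ b) = 0 & norm1 anc = w].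

Lemma exec_on_both g w k tau u a s : (k < n)%N -> is_gate1 g w -> ready k (update tau k u) a s ->
  exists2 s', exec (on_both g) s = [:: s'] & ready k (update tau k (apply1 w u)) a s'.
Proof.
move=> lt_k gP [[r0 r1 r2 r3 r4] [anc [sE pure normE]]].
have l1 : (regs s 1 < m)%N by rewrite r1 mE.
have l2 : (regs s 2 < m)%N by rewrite r2 mE; clear -lt_k; lia.
have n2 : regs s 2 != regs s 1 by rewrite r1 r2.
have l3 : (regs s 3 < m)%N by rewrite r3 mE; clear -lt_k; lia.
have n3 : regs s 3 != regs s 1 by rewrite r1 r3.
rewrite /on_both (exec_Seq1 _ (exec_gate1 gP l2 l1 n2 sE)) r2.
set s1 := Config _ _ _ _.
have s1E : amps s1 = prod_state m (update (copies anc (update tau k u)) k.+1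
  (apply1 w (copies anc (update tau k u) k.+1))) by [].
rewrite (exec_gate1 (s := s1) gP l3 l1 n3 s1E) /= r3.
eexists; first by [].
split; first by [].
exists anc; split=> //=; apply: eq_prod_state => q lt_q b.
have nk : (n + k == k)%N = false by apply/eqP; clear -lt_k; lia.
have nkn : (n + k < n)%N = false by apply/negbTE; rewrite -leqNgt leq_addr.
rewrite /update /copies /= !eqSS nk lt_k nkn subSS addKn eqxx.
case: q lt_q => [//|q] lt_q; rewrite !eqSS subSS /=.
have [->|nq1] := eqVneq q (n + k)%N.
  by rewrite nkn addKn eqxx.
have [->|nq2] := eqVneq q k; first by rewrite lt_k.
case: ifP => // le_q; rewrite (_ : (q - n == k)%N = false) //.
by apply/eqP; move: nq1 le_q => /eqP; clear; lia.
Qed.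

(** Both outcomes are equally likely whichever basis state the previous measurement left, so the
    coin is reused without a reset. *)
Lemma coin_sqn anc b a : anc (~~ b) = 0 -> sqn (apply1 (@hadamard1 R) anc a) = norm1 anc / 2.
Proof.
move=> z; rewrite apply1_hadamard sqnM sqn_real sqrt2K /norm1 mulrC; congr (_ * _).
have s0 : sqn (0 : R[i]) = 0 by rewrite /sqn /= expr0n addr0.
by case: b z => /= ->; rewrite s0 ?mulr0 ?add0r ?addr0 // sqnM; case: a;
  rewrite /sqn /= ?oppr0 ?sqrrN ?expr1n ?expr0n ?addr0 mul1r.
Qed.

Lemma exec_coin_step c f k tau u w s : (k < n)%N ->
  (forall s', ready k (update tau k u) (w / 2) s' ->
    exists2 s'', exec c s' = [:: s''] & ready k (update tau k (f u)) (w / 2) s'') ->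
  ready k (update tau k u) w s ->
  exists s0 s1, [/\ exec (coin_step h c) s = [:: s0; s1],
    ready k (update tau k u) (w / 2) s0 & ready k (update tau k (f u)) (w / 2) s1].
Proof.
move=> lt_k cP [[r0 r1 r2 r3 r4] [anc [sE [b0 pure] normE]]].
have lt0m : (0 < m)%N by rewrite mE.
(* The branch with outcome [b] once gate, measurement and test have each counted a step; only for
   [true] does [c] follow. *)
pose st b : config R m := Config [eta regs s with 5%N |-> nat_of_bool b]
  (prod_state m (copies (fun a => if a == b then apply1 (@hadamard1 R) anc a else 0)
    (update tau k u)))
  (steps s).+3 (queries s).
have stP b : ready k (update tau k u) (w / 2) (st b).
  split; first by [].
  exists (fun a => if a == b then apply1 (@hadamard1 R) anc a else 0); split=> //.
    by exists b; case: b.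
  have s0 : sqn (0 : R[i]) = 0 by rewrite /sqn /= expr0n addr0.
  by rewrite /norm1 -normE; case: b => /=; rewrite (coin_sqn _ pure) s0 ?addr0 ?add0r.
have [s1 s1E s1P] := cP _ (stP true).
exists (st false), s1; split=> //.
have l1 : (regs s 1 < m)%N by rewrite r1.
have l2 : (regs s 2 < m)%N by rewrite r2 mE; clear -lt_k; lia.
have n1 : regs s 1 != regs s 2 by rewrite r1 r2.
rewrite /coin_step (exec_Seq1 _ (exec_gate1 hP l1 l2 n1 sE)) r1.
set s2 := Config _ _ _ _.
have lt1 : (regs s2 1 < m)%N by rewrite /= r1.
have := exec_Meas 5 lt1.
rewrite [map _ _]/= r1 !project_prod_state // => /exec_Seq2 ->.
have e b : prod_state m (update (update (copies anc (update tau k u)) 0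
     (apply1 (@hadamard1 R) (copies anc (update tau k u) 0))) 0
     (fun a => if a == b then update (copies anc (update tau k u)) 0
        (apply1 (@hadamard1 R) (copies anc (update tau k u) 0)) 0%N a else 0)) =
   prod_state m (copies (fun a => if a == b then apply1 (@hadamard1 R) anc a else 0)
    (update tau k u)).
  by apply: eq_prod_state => q _ a; rewrite /update /copies; case: eqP => // ->.
by rewrite !e /= r4 /= -[exec c _]/(exec c (st true)) s1E.
Qed.

(** Three coin steps fork a branch into eight of equal weight. Indexing them by [coins] turns the
    sum over branches into the mean over probes. *)
Lemma ready_probe_qubit k tau w s : (k < n)%N -> tau k = @ket0 R -> ready k tau w s ->
  exists2 ss : coins -> config R m,
    forall F, branch_sum (probe_qubit h t) F s = \sum_x F (ss x) &
    forall x, ready k.+1 (update tau k (probe R x)) (w / 8) (ss x).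
Proof.
move=> lt_k tau_k sP.
have step c f : (forall u w s', ready k (update tau k u) w s' ->
      exists2 s'', exec c s' = [:: s''] & ready k (update tau k (f u)) w s'') ->
    forall u w s, ready k (update tau k u) w s ->
    exists ss : bool -> config R m,
      (forall F, branch_sum (coin_step h c) F s = \sum_b F (ss b)) /\
      forall b, ready k (update tau k (if b then f u else u)) (w / 2) (ss b).
  move=> cP u w' s' s'P.
  have [s0 [s1 [E P0 P1]]] := exec_coin_step lt_k (cP u _) s'P.
  exists (fun b => if b then s1 else s0); split=> [F|[]] //.
  by rewrite /branch_sum E big_cons big_seq1 big_bool addrC.
have both g w0 (gP : is_gate1 g w0) u w' s' :
    ready k (update tau k u) w' s' -> exists2 s'', exec (on_both g) s' = [:: s''] &
      ready k (update tau k (apply1 w0 u)) w' s''.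
  exact: exec_on_both.
have both2 g w0 (gP : is_gate1 g w0) u w' s' :
    ready k (update tau k u) w' s' ->
    exists2 s'', exec (Seq (on_both g) (on_both g)) s' = [:: s''] &
      ready k (update tau k (apply1 w0 (apply1 w0 u))) w' s''.
  move=> /(both g w0 gP)[s1 E1 /(both g w0 gP)[s2 E2 P2]].
  by exists s2; rewrite ?(exec_Seq1 _ E1).
have stepH := step _ _ (both _ _ hP).
have stepT := step _ _ (both2 _ _ tP).
have sP0 : ready k (update tau k (@ket0 R)) w s.
  rewrite (_ : update tau k _ = tau) //.
  by apply/funext => j; rewrite /update; case: eqP => [->|].
have [ss1 [E1 P1]] := stepH _ _ _ sP0.
have /choice[ss2 P2] b1 := stepT _ _ _ (P1 b1).
have /choice[ss3 P3] (b : bool * bool) := stepH _ _ _ ((P2 b.1).2 b.2).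
pose incr s' : config R m := Config
  [eta [eta regs s' with 2%N |-> (regs s' 2).+1] with 3%N |-> (regs s' 3).+1]
  (amps s') (steps s').+2 (queries s').
exists (fun x : coins => incr (ss3 x.1 x.2)) => [F|[[b1 b2] b3]].
  rewrite sum_coins branch_sum_Seq E1; apply: eq_bigr => b1 _.
  rewrite branch_sum_Seq (P2 b1).1; apply: eq_bigr => b2 _.
  rewrite branch_sum_Seq (P3 (b1, b2)).1; apply: eq_bigr => b3 _.
  by rewrite /branch_sum /= big_seq1.
have [[r0 r1 r2 r3 r4] [anc [sE pure normE]]] := (P3 (b1, b2)).2 b3.
split; first by rewrite /= r0 r1 r2 r3 r4 addnS.
by exists anc; split=> //; rewrite normE /=; field.
Qed.

Definition probed (k : nat) (c : nat -> coins) : nat -> bool -> R[i] :=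
  fun j => if (j < k)%N then probe R (c j) else @ket0 R.

Lemma sum_probe_loop k (F : config R m -> R) (G : (nat -> coins) -> R) s c w :
  (k <= n)%N ->
  (forall c w s, ready k (probed k c) w s -> F s = w * G c) ->
  ready 0 (probed 0 c) w s ->
  \sum_(s' <- iter k (fun ss => flatten [seq exec (probe_qubit h t) (tick s') | s' <- ss])
    [:: s]) F s' = w * avg k G c.
Proof.
elim: k F G => [|k IH] F G le_k FG sP /=; first by rewrite big_seq1 (FG c w).
rewrite big_flatten big_map.
(* [iter] adds turns at the end, so the last turn, on qubit [k], is absorbed into the summed
   function, just as [avg] averages over coin [k] first. *)
apply: (IH _ (fun c => 8^-1 * \sum_x G (fun j => if j == k then x else c j)) (ltnW le_k)) => //.
move=> c' w' s' s'P.
have probed_k : probed k c' k = @ket0 R by rewrite /probed ltnn.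
have tickP : ready k (probed k c') w' (tick s') by [].
have [ss sumE ssP] := ready_probe_qubit le_k probed_k tickP.
rewrite [LHS]sumE mulrA big_distrr; apply: eq_bigr => x _.
apply: FG; have := ssP x; congr (ready _ _ _ _).
apply/funext => j; rewrite /update /probed ltnS.
by case: (ltngtP j k).
Qed.

End Program.

Section BranchSum.
Variables (R : realType) (gates : seq 'M[R[i]]_(2 ^ 2)) (n m : nat).
Variables (U : 'M[R[i]]_(2 ^ n)) (F : config R m -> R) (c : cmd).
Implicit Type s : config R m.

Lemma branch_sum_Query r a s : regs s r = a -> (a + n <= m)%N ->
  branch_sum gates U (Seq (Query r) c) F s =
  branch_sum gates U c F (Config (regs s) (act_on m (@block_pos n a) U *m amps s)
    (steps s).+1 (queries s).+1).
Proof.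
move=> ra le_a; rewrite branch_sum_Seq {1}/branch_sum /= big_seq1 /exec_query /= ra le_a.
by [].
Qed.

Lemma branch_sum_Meas r r' a s : regs s r = a -> (a < m)%N ->
  branch_sum gates U (Seq (Meas r r') c) F s =
  \sum_(b : bool) branch_sum gates U c F (Config [eta regs s with r' |-> nat_of_bool b]
    (project a b (amps s)) (steps s).+1 (queries s)).
Proof.
move=> ra lt_a; rewrite branch_sum_Seq {1}/branch_sum /= /exec_measure /= ra lt_a.
by rewrite !big_cons big_nil addr0 big_bool addrC.
Qed.

End BranchSum.

Definition outcome_pr (R : realType) (n : nat) (b : bool) (v : 'cV[R[i]]_(2 ^ n)) : R :=
  vsqn (project 0 b v).

Definition accept_weight (R : realType) (m : nat) (s : config R m) : R :=
  if regs s 1 != 0%N then vsqn (amps s) else 0.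

(** The copies stay in a product state, so their outcomes are independent and agree on [b] with the
    squared probability of [b]; the coin contributes the factor [w]. *)
Lemma branch_sum_compare (R : realType) (gates : seq 'M[R[i]]_(2 ^ 2)) (n m : nat)
    (U : 'M[R[i]]_(2 ^ n)) c w (s : config R m) :
  m = (n + n).+1 -> (0 < n)%N -> ready n n (probed R n c) w s ->
  branch_sum gates U compare_copies (@accept_weight R m) s =
  w * \sum_b outcome_pr b (U *m probe_state R n c) ^+ 2.
Proof.
move=> mE lt0n [[r0 r1 r2 r3 r4] [anc [sE _ normE]]].
have stateE : amps s = tensor m anc (probe_state R n c) (probe_state R n c).
  rewrite sE; apply: prod_state_tensor => // j lt_j b; rewrite /copies /probed /=.
    by rewrite lt_j.
  by rewrite ltnNge leq_addr /= subSS addKn lt_j.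
set phi := U *m probe_state R n c.
have lt1 : (1 < m)%N by rewrite mE; clear -lt0n; lia.
have lt2 : (n.+1 < m)%N by rewrite mE; clear -lt0n; lia.
rewrite (branch_sum_Query _ _ _ _ r4); last by rewrite mE; clear; lia.
rewrite (@branch_sum_Query _ _ _ _ _ _ _ 2 n.+1) ?mE ?addSn //=.
rewrite stateE (act_on_tensor1 mE) (act_on_tensor2 mE) -/phi.
rewrite (@branch_sum_Meas _ _ _ _ _ _ _ _ _ 1%N) // big_distrr; apply: eq_bigr => b _.
rewrite (@branch_sum_Meas _ _ _ _ _ _ _ _ _ n.+1) //= project_tensor1 //.
rewrite big_bool /= !project_tensor2 //.
rewrite /branch_sum /= r1; case: b; rewrite /= !big_seq1 /accept_weight /= r1 /=;
  by rewrite ?addr0 ?add0r (vsqn_tensor mE) normE mulrA.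
Qed.

Lemma prod_state_ket0 (R : realType) (m : nat) :
  prod_state m (fun=> @ket0 R) = \col_x (nat_of_ord x == 0%N)%:R.
Proof.
apply/matrixP => x y; rewrite [y]ord1 !mxE {y}.
have q0 q : qubit 0 q = false by rewrite /qubit div0n.
have [x0|nx] := eqVneq (nat_of_ord x) 0%N.
  by rewrite big1 // => q _; rewrite x0 q0.
have [q /negbTE nq] : exists q : 'I_m, ~~ ~~ qubit x q.
  apply/existsP; apply: contraR nx; rewrite negb_exists => /forallP h.
  apply/eqP; apply: (@qubit_inj m) => [||q lt_q]; rewrite ?expn_gt0 ?ltn_ord //.
  by rewrite q0; apply/negbTE; have := h (Ordinal lt_q); rewrite negbK.
by rewrite (bigD1 q) //= {1}/ket0 nq mul0r.
Qed.

Section Acceptance.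
Variables (R : realType) (gates : seq 'M[R[i]]_(2 ^ 2)) (h t : nat) (A : algorithm).
Hypothesis hP : is_gate1 gates h (@hadamard1 R).
Hypothesis tP : is_gate1 gates t (@phase1 R).
Hypothesis progA : prog A = distinguisher h t.
Hypothesis memA : forall n, (memory A).[n] = (n + n).+1.

Lemma accept_prE (n : nat) (U : 'M[R[i]]_(2 ^ n)) c : (0 < n)%N ->
  accept_pr gates A U =
  avg n (fun c => \sum_b outcome_pr b (U *m probe_state R n c) ^+ 2) c.
Proof.
move=> lt0n; rewrite /accept_pr /run progA big_mkcond -/(branch_sum _ _ _ (@accept_weight R _) _).
set s0 := start _ _.
have mE := memA n.
(* [s1] is the configuration after the four initial register commands. The all-zero memory meets the
   invariant with weight 1. *)
have [s1 s1P sumE] : exists2 s1 : config R (memory A).[n], ready n 0 (probed R 0 c) 1 s1 &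
    forall F, branch_sum gates U (distinguisher h t) F s0 =
      branch_sum gates U (Seq (Loop 0 (probe_qubit h t)) compare_copies) F s1.
  eexists; last by move=> F; rewrite /distinguisher; do 4! (rewrite branch_sum_Seq
    {1}/branch_sum [exec _ _ _ _]/= big_seq1).
  split; first by rewrite /= addn0.
  exists (@ket0 R); split; last 2 first.
  - by exists false; rewrite /ket0.
  - by rewrite /norm1 /ket0 /sqn /= expr1n expr0n !addr0.
  rewrite /= -prod_state_ket0; apply: eq_prod_state => q _ b.
  by rewrite /copies /probed; case: eqP => // _; case: ifP.
rewrite sumE branch_sum_Seq.
have r0 : regs s1 0 = n by case: s1P => -[].
rewrite {1}/branch_sum /= r0.
have FG c' w (s : config R (memory A).[n]) : ready n n (probed R n c') w s ->
    branch_sum gates U compare_copies (@accept_weight R _) s =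
    w * \sum_b outcome_pr b (U *m probe_state R n c') ^+ 2.
  exact: branch_sum_compare.
have s1P' : ready n 0 (probed R 0 c) 1 (tick s1) := s1P.
by have := sum_probe_loop U mE hP tP (leqnn n) FG s1P'; rewrite mul1r.
Qed.

End Acceptance.

(** * Acceptance probability for unitary and for shallow oracles *)

Section UnitaryAcceptance.
Variables (R : realType) (n : nat).
Implicit Types (U : 'M[R[i]]_(2 ^ n)) (v : 'cV[R[i]]_(2 ^ n)).

Lemma outcome_prE b v : outcome_pr b v = \sum_(x : 'I_(2 ^ n) | qubit x 0 == b) sqn (v x 0).
Proof.
rewrite [RHS]big_mkcond; apply: eq_bigr => x _; rewrite mxE.
by case: ifP => // _; rewrite /sqn /= expr0n addr0.
Qed.

Lemma outcome_prD v : outcome_pr false v + outcome_pr true v = vsqn v.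
Proof.
rewrite !outcome_prE /vsqn [RHS](bigID (fun x : 'I_(2 ^ n) => qubit x 0 == false)) /=.
by congr (_ + _); apply: eq_bigl => x; case: (qubit x 0).
Qed.

Lemma expval_pauliZ0 v :
  expval (pauliZ R n 0) v = (outcome_pr false v - outcome_pr true v)%:C.
Proof.
rewrite expvalE !outcome_prE [RHS]rmorphB !rmorph_sum /=.
transitivity (\sum_(x : 'I_(2 ^ n)) sgn_bit R 0 x * (sqn (v x 0))%:C).
  apply: eq_bigr => x _; rewrite (bigD1 x) //= big1 ?addr0 => [|y /negbTE nyx].
    by rewrite mxE eqxx mul_conj_sqn mulrC.
  by rewrite mxE eq_sym nyx mulr0.
rewrite (bigID (fun x : 'I_(2 ^ n) => qubit x 0 == false)) /= -sumrN.
congr (_ + _); last rewrite [RHS](eq_bigl (fun x : 'I_(2 ^ n) => qubit x 0 != false)).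
- by apply: eq_bigr => x /eqP x0; rewrite /sgn_bit x0 expr0 mul1r.
- apply: eq_bigr => x; rewrite /sgn_bit; case: (qubit x 0) => // _.
  by rewrite expr1 mulN1r.
- by move=> x; case: (qubit x 0).
Qed.

Lemma vsqn_unitary U v : U \is unitarymx -> vsqn (U *m v) = vsqn v.
Proof.
rewrite unitarymx_adj => /eqP uU; apply: complexI.
by rewrite -[LHS]expval_mul uU expval1.
Qed.

Lemma row_sqn_unitary U : U \is unitarymx -> row_sqn U = 1.
Proof.
rewrite unitarymx_adj => /eqP/mulmx1C uU; apply: complexI; rewrite /row_sqn rmorph_sum.
transitivity ((U *m adj U) (bits n (fun=> false)) (bits n (fun=> false))).
  rewrite mxE; apply: eq_bigr => y _.
  by rewrite adjE mulrC mul_conj_sqn.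
by rewrite uU mxE eqxx.
Qed.

(** With p + q = 1, p^2 + q^2 = (1 + (p - q)^2) / 2, and p - q is the expectation of Z. *)
Lemma sum_outcome_pr_sqr v : vsqn v = 1 ->
  \sum_b outcome_pr b v ^+ 2 =
  2^-1 + 2^-1 * complex.Re (expval (pauliZ R n 0) v) ^+ 2.
Proof.
move=> v1; rewrite big_bool expval_pauliZ0 /=.
have := outcome_prD v; rewrite v1 => e.
have -> : outcome_pr true v = 1 - outcome_pr false v by rewrite -e addrC addKr.
by field.
Qed.

Lemma avg_outcome_unitary U c : U \is unitarymx ->
  avg n (fun c => \sum_b outcome_pr b (U *m probe_state R n c) ^+ 2) c =
  2^-1 + 2^-1 *
    avg n (fun c => complex.Re (expval (pauliZ R n 0) (U *m probe_state R n c)) ^+ 2) c.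
Proof.
move=> uU; rewrite -avgZ -[X in X + _](avg_cst n _ c) -avgD; apply: eq_avg => c'.
by rewrite sum_outcome_pr_sqr // vsqn_unitary // vsqn_probe_state.
Qed.

Lemma avg_expval_shallow d U c : (0 < n)%N -> depth_circuits d U ->
  48^-1 ^+ (2 ^ d) <=
  avg n (fun c => complex.Re (expval (pauliZ R n 0) (U *m probe_state R n c)) ^+ 2) c.
Proof.
move=> lt0n dU; have uU := depth_circuits_unitary dU.
have [T tT leT] := depth_circuits_cone lt0n dU.
pose O := adj U *m pauliZ R n 0 *m U.
pose P q := q \in [seq val j | j <- enum T].
have triv q : (q < n)%N -> ~~ P q -> trivial_on q O.
  move=> lt_q nP; apply: (tT (Ordinal lt_q)); apply: contra nP => qT.
  by apply/mapP; exists (Ordinal lt_q); rewrite ?mem_enum.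
(* Unitarity of [O] fixes its [row_sqn] at 1, whatever the circuit. *)
have uO : O \is unitarymx.
  have uA : adj U \is unitarymx.
    by rewrite unitarymx_adj adjK; apply/eqP/mulmx1C/eqP; rewrite -unitarymx_adj.
  have uZ : pauliZ R n 0 \is unitarymx by rewrite unitarymx_adj pauliZ_adj pauliZ_sqr.
  exact: mul_unitarymx (mul_unitarymx uA uZ) uU.
have := avg_expval_lower c triv; rewrite (row_sqn_unitary uO) mulr1.
have -> : avg n (fun c => sqn (expval O (probe_state R n c))) c =
    avg n (fun c => complex.Re (expval (pauliZ R n 0) (U *m probe_state R n c)) ^+ 2) c.
  apply: eq_avg => c'; rewrite expval_conj expval_pauliZ0; exact: sqn_real.
(* As 1/48 is at most 1, its powers decrease, and it remains to bound the number of qubits in the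
   cone by 2^d. *)
apply: le_trans; apply: ler_wiXn2l.
- by rewrite invr_ge0 ler0n.
- by rewrite invf_le1 ?ltr0n // ler1n.
apply: leq_trans leT; rewrite cardE -(size_map val) -size_filter.
apply: uniq_leq_size; first by rewrite filter_uniq // iota_uniq.
by move=> q; rewrite mem_filter => /andP[].
Qed.

End UnitaryAcceptance.

(** * Running time and number of queries *)

Fixpoint cost (n : nat) (c : cmd) : nat :=
  match c with
  | Skip => 0
  | Seq c1 c2 => cost n c1 + cost n c2
  | IfEq _ _ c1 c2 => (cost n c1 + cost n c2).+1
  | Loop _ c1 => (n * (cost n c1).+1).+1
  | _ => 1
  end.

Fixpoint query_cost (n : nat) (c : cmd) : nat :=
  match c with
  | Seq c1 c2 => query_cost n c1 + query_cost n c2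
  | IfEq _ _ c1 c2 => query_cost n c1 + query_cost n c2
  | Loop _ c1 => n * query_cost n c1
  | Query _ => 1
  | _ => 0
  end.

(** Writing to register 0 is excluded as well, so every loop makes exactly as many turns as the
    input says and [cost] is a valid static bound. *)
Fixpoint loops_on_input (c : cmd) : bool :=
  match c with
  | Skip | Gate _ _ _ | Query _ => true
  | Seq c1 c2 | IfEq _ _ c1 c2 => loops_on_input c1 && loops_on_input c2
  | Incr r | Decr r | Copy r _ | Meas _ r => r != 0%N
  | Loop r c1 => (r == 0%N) && loops_on_input c1
  end.

Lemma all_flatten_map (T S : Type) (p : pred T) (q : pred S) (f : T -> seq S) ss :
  all p ss -> (forall x, p x -> all q (f x)) -> all q (flatten [seq f x | x <- ss]).
Proof.
move=> ps pq; elim: ss ps => //= x ss IH /andP[px ps].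
by rewrite all_cat pq // IH.
Qed.

Definition within (R : realType) (m n S Q : nat) (s : config R m) : bool :=
  [&& regs s 0 == n, steps s <= S & queries s <= Q]%N.

Lemma within_le (R : realType) (m n S Q S' Q' : nat) (s : config R m) :
  (S <= S')%N -> (Q <= Q')%N -> within n S Q s -> within n S' Q' s.
Proof.
by move=> leS leQ /and3P[e s1 s2]; rewrite /within e (leq_trans s1) // (leq_trans s2).
Qed.

Lemma exec_cost (R : realType) (gates : seq 'M[R[i]]_(2 ^ 2)) (n m : nat)
    (U : 'M[R[i]]_(2 ^ n)) (c : cmd) (N S Q : nat) (s : config R m) :
  loops_on_input c -> within N S Q s ->
  all (within N (S + cost N c) (Q + query_cost N c)) (exec gates U c s).
Proof.
elim: c S Q s => [|c1 IH1 c2 IH2|r|r|r r'|r r' c1 IH1 c2 IH2|r c IH|g r r'|r|r r'] S Q s /=.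
- by rewrite !addn0 => _ ->.
- case/andP=> ok1 ok2 sP; rewrite !addnA.
  by apply: all_flatten_map (IH1 _ _ _ ok1 sP) _ => s'; apply: IH2.
- by rewrite /within /= eq_sym => /negbTE -> /and3P[-> leS leQ]; rewrite addn1 addn0 ltnS leS leQ.
- by rewrite /within /= eq_sym => /negbTE -> /and3P[-> leS leQ]; rewrite addn1 addn0 ltnS leS leQ.
- by rewrite /within /= eq_sym => /negbTE -> /and3P[-> leS leQ]; rewrite addn1 addn0 ltnS leS leQ.
- case/andP=> ok1 ok2 sP.
  have tP : within N S.+1 Q (tick s) by [].
  case: ifP => _.
    apply: sub_all (IH1 _ _ _ ok1 tP) => s'; apply: within_le; last by rewrite leq_add2l leq_addr.
    by rewrite addSnnS leq_add2l ltnS leq_addr.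
  apply: sub_all (IH2 _ _ _ ok2 tP) => s'; apply: within_le; last by rewrite leq_add2l leq_addl.
  by rewrite addSnnS leq_add2l ltnS leq_addl.
- case/andP=> /eqP-> ok sP; have /and3P[/eqP-> _ _] := sP.
  rewrite -addSnnS.
  suff all_iter k : all (within N (S.+1 + k * (cost N c).+1) (Q + k * query_cost N c))
      (iter k (fun ss => flatten [seq exec gates U c (tick s') | s' <- ss]) [:: tick s]).
    exact: all_iter.
  elim: k => [|k IHk] /=.
    by rewrite !mul0n !addn0 andbT.
  apply: all_flatten_map IHk _ => s' s'P; rewrite !mulSn ![(_ + k * _)%N]addnC !addnA -addSnnS.
  by apply: IH.
- move=> _ sP; rewrite andbT addn1 addn0 /exec_gate.
  by case: ifP.
- move=> _ /and3P[e leS leQ]; rewrite andbT !addn1 /exec_query /=.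
  by case: ifP => _; rewrite /within /= e !ltnS leS leQ.
- rewrite eq_sym => /negbTE nr /and3P[e leS leQ]; rewrite addn1 addn0 /exec_measure.
  by case: ifP => _; rewrite /= /within /= nr e !ltnS leS leQ.
Qed.

Section Distinguisher.
Variables (R : realType) (gates : seq 'M[R[i]]_(2 ^ 2)).

Definition hadamard_index : nat := index (act_on 2 (fun _ : 'I_1 => 0%N) (hadamard_mx R)) gates.
Definition phase_index : nat := index (act_on 2 (fun _ : 'I_1 => 0%N) (T_mx R)) gates.

Definition correlation_test : algorithm :=
  Algorithm (distinguisher hadamard_index phase_index) (2%:P * 'X + 1).

Lemma memory_correlation_test n : (memory correlation_test).[n] = (n + n).+1.
Proof. by rewrite /= !hornerE; lia. Qed.

Lemma within_run (n : nat) (U : 'M[R[i]]_(2 ^ n)) :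
  all (within n (cost n (prog correlation_test)) (query_cost n (prog correlation_test)))
    (run gates correlation_test U).
Proof.
apply: (@exec_cost R gates n _ U (prog correlation_test) n 0 0); first by [].
by rewrite /within /= eqxx.
Qed.

Lemma poly_time_correlation_test : poly_time gates correlation_test.
Proof.
(* [cost] evaluates to 20 n + 11: a turn of the loop counts 20 steps, everything else 11. *)
exists (30%:P * 'X + 20%:P) => n U _.
apply: sub_all (within_run U) => s /and3P[_ + _] => /leq_trans; apply.
have -> : (30%:P * 'X + 20%:P : {poly nat}).[n] = (30 * n + 20)%N.
  by rewrite hornerD hornerM !hornerC hornerX; lia.
rewrite /=; clear; lia.
Qed.

Lemma makes_queries_correlation_test : makes_queries gates correlation_test (fun=> 2%N).
Proof.
move=> n U _; apply: sub_all (within_run U) => s /and3P[_ _ /leq_trans]; apply.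
by rewrite /= muln0.
Qed.

Hypothesis hgates : gate_set gates.

Lemma is_gate1_hadamard : is_gate1 gates hadamard_index (@hadamard1 R).
Proof.
have hg : act_on 2 (fun _ : 'I_1 => 0%N) (hadamard_mx R) \in gates.
  by apply: hgates.2; rewrite inE eqxx.
split; first by rewrite index_mem.
by exists (hadamard_mx R); [rewrite nth_index|move=> x y; rewrite mxE].
Qed.

Lemma is_gate1_phase : is_gate1 gates phase_index (@phase1 R).
Proof.
have tg : act_on 2 (fun _ : 'I_1 => 0%N) (T_mx R) \in gates.
  by apply: hgates.2; rewrite !inE eqxx orbT.
split; first by rewrite index_mem.
exists (T_mx R); [by rewrite nth_index|move=> x y; rewrite mxE /phase1].
congr (if ~~ _ then _ else _); apply/eqP/eqP => [->//|e].
by apply: qubit_ord_inj => -[].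
Qed.

(** Stated for every matrix, because measurability concerns the whole matrix space and not only the
    unitaries. *)
Lemma accept_pr_correlation_test (n : nat) (U : 'M[R[i]]_(2 ^ n)) c : (0 < n)%N ->
  accept_pr gates correlation_test U =
  avg n (fun c => \sum_b outcome_pr b (U *m probe_state R n c) ^+ 2) c.
Proof.
move=> lt0n; apply: (accept_prE (h := hadamard_index) (t := phase_index)) => //.
- exact: is_gate1_hadamard.
- exact: is_gate1_phase.
- exact: memory_correlation_test.
Qed.

End Distinguisher.

(** * Measurability and Haar invariance *)

(** Neighbourhoods of a matrix are given entrywise, and each of the finitely many entries of the
    product is a linear combination of coordinates. *)
Lemma continuous_mulmxl (K : numFieldType) (N : nat) (V : 'M[K]_N) :
  continuous (mulmx V : 'M[K]_N -> 'M[K]_N).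
Proof.
move=> M A [P MP sPA].
have entry x y : continuous (fun M : 'M[K]_N => (V *m M) x y).
  rewrite (_ : (fun _ => _) = \sum_k (fun M : 'M[K]_N => V x k * M k y)).
    elim/big_ind: _ => [|f g cf cg|k _] M'.
    - exact: cst_continuous.
    - by apply: continuousD; [exact: cf|exact: cg].
    - by apply: continuousM; [exact: cst_continuous|exact: coord_continuous].
  by apply/funext => M'; rewrite mxE fct_sumE.
have near_entry (xy : 'I_N * 'I_N) :
    \forall M' \near M, P xy.1 xy.2 ((V *m (M' : 'M[K]_N)) xy.1 xy.2).
  exact: entry (MP xy.1 xy.2).
suff : \forall M' \near M, A (V *m (M' : 'M[K]_N)) by [].
near=> M'; apply: sPA => x y.
have all_entries : forall xy : 'I_N * 'I_N, P xy.1 xy.2 ((V *m M') xy.1 xy.2).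
  by near: M'; exact: filter_forall near_entry.
exact: (all_entries (x, y)).
Unshelve. all: by end_near.
Qed.

Lemma continuous_Re (R : realType) : continuous (@complex.Re R : R[i] -> R).
Proof.
move=> z A /nbhs_ballP[e e0 eA].
suff : nbhs z (@complex.Re R @^-1` A) by [].
apply/nbhs_ballP; exists e%:C => [|w zw]; first by rewrite /= ltcR.
apply: eA; rewrite /ball /= -ltcR; apply: le_lt_trans zw.
by rewrite -raddfB; exact: normc_ge_Re.
Qed.

Lemma measurable_continuous_borel_mx (R : realType) (n : nat) (f : borel_mx R n -> R) :
  continuous (f : 'M[R[i]]_(2 ^ n) -> R) -> measurable_fun setT f.
Proof.
move=> cf; apply: (measurability _ (RGenOInfty.measurableE R)) => //.
move=> _ [_ [a ->] <-]; rewrite setTI; apply: sub_sigma_algebra.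
by move/continuousP : cf; apply; exact: interval_open.
Qed.

Lemma normc_ge_Im (R : realType) (z : R[i]) : `|complex.Im z|%:C <= `|z|.
Proof.
rewrite -[`|z|]mulr1 -[X in _ * X](_ : `|'i : R[i]| = 1).
  by rewrite -normrM -normrN -ReiNIm normc_ge_Re.
by rewrite normc_def /= expr0n expr1n add0r sqrtr1.
Qed.

Lemma continuous_Im (R : realType) : continuous (@complex.Im R : R[i] -> R).
Proof.
move=> z A /nbhs_ballP[e e0 eA].
suff : nbhs z (@complex.Im R @^-1` A) by [].
apply/nbhs_ballP; exists e%:C => [|w zw]; first by rewrite /= ltcR.
apply: eA; rewrite /ball /= -ltcR; apply: le_lt_trans zw.
by rewrite -raddfB; exact: normc_ge_Im.
Qed.

Section ComplexMeasurable.
Variables (R : realType) (n : nat).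
Implicit Types (f g : borel_mx R n -> R[i]).

Definition cmeasurable f : Prop :=
  measurable_fun setT (fun U => complex.Re (f U)) /\
  measurable_fun setT (fun U => complex.Im (f U)).

Lemma cmeasurable_entry x y : cmeasurable (fun U : 'M[R[i]]_(2 ^ n) => U x y).
Proof.
split; apply: measurable_continuous_borel_mx => M.
  by apply: (@continuous_comp _ _ _ (fun M : 'M[R[i]]_(2 ^ n) => M x y) (@complex.Re R));
    [exact: coord_continuous|exact: continuous_Re].
by apply: (@continuous_comp _ _ _ (fun M : 'M[R[i]]_(2 ^ n) => M x y) (@complex.Im R));
  [exact: coord_continuous|exact: continuous_Im].
Qed.

Lemma cmeasurable_mulr f a : cmeasurable f -> cmeasurable (fun U => f U * a).
Proof.
case: a => a b [mRe mIm]; split.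
  rewrite (_ : (fun _ => _) = (fun U => complex.Re (f U) * a - complex.Im (f U) * b)).
    apply: measurable_funB; apply: measurable_funM => //; exact: measurable_cst.
  by apply/funext => U; case: (f U).
rewrite (_ : (fun _ => _) = (fun U => complex.Re (f U) * b + complex.Im (f U) * a)).
  apply: measurable_funD; apply: measurable_funM => //; exact: measurable_cst.
by apply/funext => U; case: (f U).
Qed.

Lemma cmeasurable_sum (I : Type) (r : seq I) (f : I -> borel_mx R n -> R[i]) :
  (forall j, cmeasurable (f j)) -> cmeasurable (fun U => \sum_(j <- r) f j U).
Proof.
move=> mf; split.
  rewrite (_ : (fun _ => _) = (fun U => \sum_(j <- r) complex.Re (f j U))).
    by apply: measurable_sum => j; case: (mf j).
  by apply/funext => U; rewrite raddf_sum.
rewrite (_ : (fun _ => _) = (fun U => \sum_(j <- r) complex.Im (f j U))).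
  by apply: measurable_sum => j; case: (mf j).
by apply/funext => U; rewrite raddf_sum.
Qed.

Lemma measurable_sqn f : cmeasurable f -> measurable_fun setT (fun U => sqn (f U)).
Proof. by case=> mRe mIm; apply: measurable_funD; apply: measurable_funX. Qed.

Lemma measurable_outcome_pr b (v : 'cV[R[i]]_(2 ^ n)) :
  measurable_fun setT (fun U : borel_mx R n => outcome_pr b ((U : 'M[R[i]]_(2 ^ n)) *m v)).
Proof.
rewrite (_ : (fun _ => _) = (fun U : borel_mx R n => \sum_(x <- index_enum 'I_(2 ^ n))
    (if qubit x 0 == b then sqn (\sum_(y <- index_enum 'I_(2 ^ n))
      (U : 'M[R[i]]_(2 ^ n)) x y * v y 0) else 0))).
  apply: measurable_sum => x; case: (qubit x 0 == b); last exact: measurable_cst.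
  apply: measurable_sqn; apply: cmeasurable_sum => y.
  exact: cmeasurable_mulr (cmeasurable_entry x y).
apply/funext => U; rewrite outcome_prE big_mkcond; apply: eq_bigr => x _.
by rewrite mxE.
Qed.

Lemma measurable_avg k (F : borel_mx R n -> (nat -> coins) -> R) c :
  (forall c, measurable_fun setT (F^~ c)) -> measurable_fun setT (fun U => avg k (F U) c).
Proof.
elim: k F c => [|k IH] F c mF /=; first exact: mF.
apply: (IH (fun U c => _)) => {}c; apply: measurable_funM; first exact: measurable_cst.
by apply: measurable_sum => x; exact: mF.
Qed.

(** The branches of a run depend on [U], but the closed form is a fixed finite sum of polynomials in
    the real and imaginary parts of the entries. *)
Lemma measurable_accept_pr (gates : seq 'M[R[i]]_(2 ^ 2)) : gate_set gates -> (0 < n)%N ->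
  measurable_fun setT (fun U : borel_mx R n => accept_pr gates (correlation_test gates) U).
Proof.
move=> hgates lt0n.
rewrite (_ : (fun _ => _) = (fun U : borel_mx R n => avg n (fun c => \sum_b outcome_pr b
   ((U : 'M[R[i]]_(2 ^ n)) *m probe_state R n c) ^+ 2) (fun=> (false, false, false)))).
  apply: (@measurable_avg n (fun U c => _)) => c.
  apply: measurable_sum => b; apply: measurable_funX; exact: measurable_outcome_pr.
by apply/funext => U; exact: accept_pr_correlation_test.
Qed.

Lemma measurable_mulmxl (V : 'M[R[i]]_(2 ^ n)) :
  measurable_fun setT (mulmx V : borel_mx R n -> borel_mx R n).
Proof.
apply: (@measurability _ _ (borel_mx R n) (borel_mx R n) setT (mulmx V)
  (@open 'M[R[i]]_(2 ^ n))) => //.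
move=> _ [A oA <-]; rewrite setTI; apply: sub_sigma_algebra.
by have /continuousP := @continuous_mulmxl R[i] (2 ^ n) V; apply.
Qed.

(** Left invariance says that [P] is its own image under [mulmx V]; the rest is change of
    variables. *)
Lemma haar_integral (P : probability (borel_mx R n) R) (V : 'M[R[i]]_(2 ^ n))
    (f : borel_mx R n -> \bar R) :
  is_haar P -> V \is unitarymx -> measurable_fun setT f -> (forall U, 0 <= f U)%E ->
  (\int[P]_U f (V *m (U : 'M[R[i]]_(2 ^ n))) = \int[P]_U f U)%E.
Proof.
move=> [_ haar] uV mf f0.
have mV := measurable_mulmxl V.
have := @ge0_integral_pushforward _ _ _ _ R _ mV P setT f measurableT mf (fun U _ => f0 U).
rewrite preimage_setT => <-.
apply: (eq_measure_integral P) => A mA _.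
by have [] := haar V uV A mA.
Qed.

End ComplexMeasurable.

Lemma ae_imply (R : realType) (d : measure_display) (T : measurableType d)
    (P : probability T R) (A B : T -> Prop) :
  (forall x, A x -> B x) -> {ae P, forall x, A x} -> {ae P, forall x, B x}.
Proof.
move=> AB [N [mN N0 sAN]]; exists N; split=> //.
by move=> x /= nB; apply: sAN => /AB.
Qed.

(** * Mean acceptance under the Haar measure and under shallow circuits *)

Section Bounds.
Variables (R : realType) (n : nat) (gates : seq 'M[R[i]]_(2 ^ 2)).
Hypotheses (hgates : gate_set gates) (lt0n : (0 < n)%N).
Implicit Types (P : probability (borel_mx R n) R) (U : 'M[R[i]]_(2 ^ n)).

Let accept U : R := accept_pr gates (correlation_test gates) U.
(** An arbitrary value: [avg n] overwrites all the coins that [probe_state R n] reads. *)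
Let c0 : nat -> coins := fun=> (false, false, false).

Lemma accept_ge0 U : 0 <= accept U.
Proof.
rewrite /accept (accept_pr_correlation_test hgates U c0) // -[leLHS](avg_cst n 0 c0).
by apply: avg_le => c; apply: sumr_ge0 => b _; exact: sqr_ge0.
Qed.

Lemma accept_le1 U : U \is unitarymx -> accept U <= 1.
Proof.
move=> uU; rewrite /accept (accept_pr_correlation_test hgates U c0) // -[leRHS](avg_cst n 1 c0).
apply: avg_le => c; have := outcome_prD (U *m probe_state R n c).
rewrite vsqn_unitary // vsqn_probe_state big_bool /=.
have ge0 b : 0 <= outcome_pr b (U *m probe_state R n c) := vsqn_ge0 _.
move: (outcome_pr _ _) (outcome_pr _ _) (ge0 true) (ge0 false) => p q p0 q0 pq; nra.
Qed.

Lemma accept_unitary U : U \is unitarymx ->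
  accept U = 2^-1 + 2^-1 *
    avg n (fun c => complex.Re (expval (pauliZ R n 0) (U *m probe_state R n c)) ^+ 2) c0.
Proof.
by move=> uU; rewrite /accept (accept_pr_correlation_test hgates U c0) // avg_outcome_unitary.
Qed.

Lemma accept_shallow d U : depth_circuits d U -> 2^-1 + 2^-1 * 48^-1 ^+ (2 ^ d) <= accept U.
Proof.
move=> dU; rewrite (accept_unitary (depth_circuits_unitary dU)) lerD2l ler_pM2l ?invr_gt0 ?ltr0n //.
exact: avg_expval_shallow.
Qed.

(** Multiplying [U] by [V j] replaces Z by the j-th Majorana operator in the same state, so
    [majorana_moment] applies for each single [U], before any integration. *)
Lemma sum_accept_rotated (V : 'I_n -> 'M[R[i]]_(2 ^ n)) U :
  (forall j, V j \is unitarymx /\ adj (V j) *m majorana R n 0 *m V j = majorana R n j) ->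
  U \is unitarymx -> \sum_j accept (V j *m U) <= n%:R / 2 + 2^-1.
Proof.
move=> VP uU.
have e j : accept (V j *m U) = 2^-1 + 2^-1 *
    avg n (fun c => complex.Re (expval (majorana R n j) (U *m probe_state R n c)) ^+ 2) c0.
  have [uV maj_j] := VP j; rewrite (accept_unitary (mul_unitarymx uV uU)).
  congr (_ + _ * _); apply: eq_avg => c.
  by rewrite -maj_j expval_conj mulmxA majorana0.
under eq_bigr => j _ do rewrite e.
rewrite big_split /= sumr_const card_ord -[2^-1 *+ n]mulr_natl lerD2l -big_distrr /=.
rewrite -[leRHS]mulr1 ler_pM2l ?invr_gt0 ?ltr0n // -avg_sum -[leRHS](avg_cst n 1 c0).
apply: avg_le => c; apply: majorana_moment.
by rewrite vsqn_unitary // vsqn_probe_state.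
Qed.

Let F : borel_mx R n -> \bar R := fun U => (accept U)%:E.

Lemma integral_accept_le P (a : R) : 0 <= a -> {ae P, forall U, accept U <= a} ->
  (\int[P]_U F U <= a%:E)%E.
Proof.
move=> a0 le_a; rewrite -[leRHS]mule1 -(@probability_setT _ _ _ P) -integral_cst //.
apply: ae_ge0_le_integral => //.
- by move=> U _; rewrite lee_fin accept_ge0.
- by apply/measurable_EFinP; exact: measurable_accept_pr.
- by apply: ae_imply le_a => U le_aU _; rewrite lee_fin.
Qed.

Lemma integral_accept_ge P (a : R) : 0 <= a -> {ae P, forall U, a <= accept U} ->
  (a%:E <= \int[P]_U F U)%E.
Proof.
move=> a0 ge_a; rewrite -[leLHS]mule1 -(@probability_setT _ _ _ P) -integral_cst //.
apply: ae_ge0_le_integral => //.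
- by move=> U _; rewrite lee_fin accept_ge0.
- by apply/measurable_EFinP; exact: measurable_accept_pr.
- by apply: ae_imply ge_a => U ge_aU _; rewrite lee_fin.
Qed.

(** The real integral is the [fine] part of the extended one; acceptance at most 1 on unitaries
    makes the latter finite. *)
Lemma integral_accept_fin P : {ae P, forall U : 'M[R[i]]_(2 ^ n), U \is unitarymx} ->
  (\int[P]_U F U)%E = (\int[P]_U accept U)%:E.
Proof.
move=> uP; rewrite /Rintegral fineK // ge0_fin_numE; last first.
  by apply: integral_ge0 => U _; rewrite lee_fin accept_ge0.
apply: le_lt_trans (ltry 1); apply: integral_accept_le => //.
by apply: ae_imply uP => U; exact: accept_le1.
Qed.

(** By invariance the integrals of the n rotated acceptances are all equal, while their sum is at
    most n/2 + 1/2; dividing by n gives the bound. *)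
Lemma haar_accept_le P : is_haar P -> \int[P]_U accept U <= 2^-1 + (2 * n%:R)^-1.
Proof.
move=> haarP; have [uP _] := haarP.
have /choice[V VP] (j : 'I_n) : exists V : 'M[R[i]]_(2 ^ n),
    V \is unitarymx /\ adj V *m majorana R n 0 *m V = majorana R n j.
  by have [V uV maj_j] := majorana_conj R (ltn_ord j); exists V.
have mF : measurable_fun setT F by apply/measurable_EFinP; exact: measurable_accept_pr.
have F0 U : (0 <= F U)%E by rewrite lee_fin accept_ge0.
have mFV j : measurable_fun setT (fun U : borel_mx R n => F (V j *m (U : 'M[R[i]]_(2 ^ n)))).
  exact: measurableT_comp mF (measurable_mulmxl (V j)).
have : (\sum_(j < n) \int[P]_U F (V j *m (U : 'M[R[i]]_(2 ^ n))) <= (n%:R / 2 + 2^-1)%:E)%E.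
  rewrite -ge0_integral_sum //.
  rewrite -[leRHS]mule1 -(@probability_setT _ _ _ P) -integral_cst //.
  apply: ae_ge0_le_integral => //.
  - by move=> U _; apply: sume_ge0.
  - exact: emeasurable_sum.
  - by move=> U _; rewrite lee_fin addr_ge0 // divr_ge0.
  - apply: ae_imply uP => U uU _; rewrite sumEFin lee_fin.
    exact: sum_accept_rotated.
under eq_bigr => j _ do rewrite (haar_integral haarP (VP j).1 mF F0) integral_accept_fin //.
rewrite sumEFin lee_fin sumr_const card_ord -[X in X <= _]mulr_natl => le_n.
have n0 : 0 < n%:R :> R by rewrite ltr0n.
rewrite -(ler_pM2l n0); apply: le_trans le_n _; rewrite mulrDr lerD2l.
by rewrite invfM mulrCA divff ?mulr1 // gt_eqF.
Qed.

Lemma circuit_accept_ge d P : circuit_ensemble d P ->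
  2^-1 + 2^-1 * 48^-1 ^+ (2 ^ d) <= \int[P]_U accept U.
Proof.
move=> dP; rewrite -lee_fin -integral_accept_fin; last first.
  by apply: ae_imply dP => U; exact: depth_circuits_unitary.
apply: integral_accept_ge; first by rewrite addr_ge0 // mulr_ge0 // exprn_ge0.
by apply: ae_imply dP => U; exact: accept_shallow.
Qed.

Lemma advantage_ge d (C muH : probability (borel_mx R n) R) :
  is_haar muH -> circuit_ensemble d C ->
  2^-1 * 48^-1 ^+ (2 ^ d) - (2 * n%:R)^-1 <=
  advantage gates (correlation_test gates) C muH.
Proof.
move=> /haar_accept_le leH /circuit_accept_ge leC; rewrite /advantage.
by apply: le_trans (ler_norm _); move: leH leC; rewrite /accept; lra.
Qed.

End Bounds.

(** * Asymptotics and conclusion *)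

Lemma bigO_query_bound (R : realType) :
  (fun=> 2%:R : R) =O_\oo (fun n => n%:R ^+ 4 * ln n%:R : R).
Proof.
have ln2 : 0 < ln 2 :> R by rewrite ln_gt0 // ltr1n.
(* From n = 2 on, n^4 ln n is at least ln 2, so every constant from 2 / ln 2 on works. *)
apply/eqOP; near=> k; near=> n.
have le2n : (2 <= n)%N by near: n; exact: nbhs_infty_ge.
have le_ln : ln 2 <= ln n%:R :> R by rewrite ler_ln ?posrE ?ltr0n ?ler_nat // (leq_trans _ le2n).
have le1 : 1 <= n%:R ^+ 4 :> R by rewrite exprn_ege1 // ler1n (leq_trans _ le2n).
have k2 : 2 / ln 2 <= k by near: k; apply: nbhs_pinfty_ge; exact: num_real.
have ln_n_ge0 : 0 <= ln n%:R :> R := le_trans (ltW ln2) le_ln.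
rewrite [`|_ * _|]ger0_norm ?mulr_ge0 ?exprn_ge0 // ger0_norm //.
have k0 : 0 <= k by apply: le_trans k2; rewrite divr_ge0 // ltW.
move: k2; rewrite ler_pdivrMr // => /le_trans; apply.
by rewrite ler_wpM2l // (le_trans le_ln) // ler_peMl.
Unshelve. all: by end_near.
Qed.

Theorem theorem5 (R : realType) (gates : seq 'M[R[i]]_(2 ^ 2))
    (hgates : gate_set gates)
    (muH : forall n : nat, probability (borel_mx R n) R)
    (hmuH : forall n : nat, is_haar (muH n))
    (d : nat) :
  (exists A : algorithm,
    [/\ poly_time gates A,
        exists2 q : nat -> nat, makes_queries gates A q &
          (fun n => (q n)%:R : R) =O_\oo (fun n => n%:R ^+ 4 * ln n%:R : R),
        exists p : {poly R}, \forall n \near \oo, 0 < p.[n%:R] /\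
          forall C : probability (borel_mx R n) R, circuit_ensemble d C ->
            1 / p.[n%:R] <= advantage gates A C (muH n) &
        forall C : forall n : nat, probability (borel_mx R n) R,
          (forall n : nat, circuit_ensemble d (C n)) ->
          ~ negl (fun n => advantage gates A (C n) (muH n))]) /\
  (forall C : forall n : nat, probability (borel_mx R n) R,
    (forall n : nat, circuit_ensemble d (C n)) -> ~ pseudorandom gates muH C).
Proof.
pose A := correlation_test gates.
pose kappa : R := 48^-1 ^+ (2 ^ d).
have k0 : 0 < kappa by rewrite exprn_gt0 // invr_gt0 ltr0n.
(* The gap is at least kappa/2 - 1/(2n). Once n reaches 2/kappa this is at least kappa/4, so a
   constant polynomial witnesses non-negligibility. *)
pose p : {poly R} := (4 / kappa)%:P.
have polyA : poly_time gates A := poly_time_correlation_test gates.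
have advA : \forall n \near \oo, 0 < p.[n%:R] /\
    forall C : probability (borel_mx R n) R, circuit_ensemble d C ->
      1 / p.[n%:R] <= advantage gates A C (muH n).
  near=> n; rewrite hornerC divr_gt0 //; split=> // C dC.
  have n0 : (0 < n)%N by near: n; exact: nbhs_infty_gt.
  have le_n : 2 / kappa <= n%:R :> R by near: n; exact: nbhs_infty_ger.
  apply: le_trans (advantage_ge hgates n0 (hmuH n) dC); rewrite -/kappa.
  have n0R : 0 < n%:R :> R by rewrite ltr0n.
  have : (2 * n%:R)^-1 <= kappa / 4.
    move: le_n; rewrite ler_pdivrMr // => le_n.
    rewrite -[leLHS]div1r ler_pdivrMr ?mulr_gt0 //; lra.
  by rewrite div1r invf_div; lra.
have notnegl (C : forall n : nat, probability (borel_mx R n) R) :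
    (forall n : nat, circuit_ensemble d (C n)) ->
    ~ negl (fun n => advantage gates A (C n) (muH n)).
  move=> dC neglC.
  have p0 : \forall n \near \oo, 0 < p.[n%:R] by apply: filterS advA => n [].
  (* Negligibility tested against the same [p] contradicts [advA] at any [n] where both hold. *)
  have [n [/= lt_n [_ /(_ _ (dC n)) le_n]]] := filter_ex (filterI (neglC p p0) advA).
  by move: lt_n; rewrite ltNge (le_trans le_n) // ler_norm.
split.
  exists A; split=> //; last by exists p.
  exists (fun=> 2%N); last exact: bigO_query_bound.
  exact: makes_queries_correlation_test.
move=> C dC [len [K [U [_ _ _ _ /(_ A polyA)]]]]; exact: notnegl.
Unshelve. all: by end_near.
Qed.
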